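(* Let $p$ be a prime, $F\in\mathscr F$, $k\ge1$, and $d=p^{k-1}(pq+r)$ with integers $q\ge0$ and $0<r<p$. If $q+r-p+1\ge2$, then $\mathrm{Res}(\mathrm{Lex}^-_{F,d}(k+1))$ is a $\left[\frac{p^k-1}{p-1}(pq+r)+q+1,\ k+1,\ d\right]$ Solomon–Stiffler code over $\mathbb F_p$.
   Context: $\mathbb N$ is the set of non-negative integers. $\mathbb F_p$ is identified with $\{0,1,\dots,p-1\}$, elements compared as integers. $\mathbb F_p^{\mathbb N}$ is the space of finitely supported sequences $(x_i)_{i\in\mathbb N}$ over $\mathbb F_p$, with standard basis $E=(e_0,e_1,\dots)$. For distinct $\xi,\eta\in\mathbb N$, $F(\xi,\eta)=(f_i)_{i\in\mathbb N}$ is the ordered basis with $f_i=e_i$ for $i\ne\xi$ and $f_\xi=e_\xi+e_\eta$. Let $\mathscr F=\{E\}\cup\{F(\xi,\eta):\xi,\eta\in\mathbb N,\ \xi\neq\eta\}$. For an ordered basis $F=(f_i)$ write $x=\sum_i x_{[i]}f_i$; for $x\neq y$ let $N$ be the largest index with $x_{[N]}\ne y_{[N]}$ and set $x<_F y$ iff $x_{[N]}<y_{[N]}$. The Hamming distance is $d(x,y)=|\{i: x_i\neq y_i\}|$ in standard coordinates. The words $w^-(a)=w^-_{F,d}(a)$ ($a\in\mathbb N$) are defined recursively: if $a$ is a power of $p$ (including $p^0=1$), $w^-(a)$ is the $<_F$-minimum $z\in\mathbb F_p^{\mathbb N}$ with $d(z,w^-(b))\ge d$ for all $0\le b<a$;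 otherwise $w^-(a)=\sum_i a_iw^-(p^i)$ where $a=\sum_i a_ip^i$ is the $p$-ary expansion (so $w^-(0)=0$). Put $\mathrm{Lex}^-_{F,d}(m)=\{w^-(0),\dots,w^-(p^m-1)\}$. For $L\subseteq\mathbb F_p^{\mathbb N}$, $\mathrm{Res}(L)$ is obtained from $L$ by deleting all standard coordinates $i$ at which every element of $L$ is zero. An $[n,m,d]$ code is a linear code of length $n$, dimension $m$ and minimum distance $d$. A Solomon–Stiffler code of dimension $m$ over $\mathbb F_p$ is a linear code with an $m$-row generator matrix whose columns, regarded as points of the projective space of one-dimensional subspaces of $\mathbb F_p^m$, form a multiset obtained as follows: take $s$ copies of every point, and remove (with multiplicity) the points of projective subspaces coming from linear subspaces $U_1,\dots,U_t\subsetneq\mathbb F_p^m$ (at most $p-1$ of them having any given dimension), where each point lies in at most $s$ of the $U_j$. *)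

(* Defs.v *)
From HB Require Import structures.
From mathcomp Require Import all_boot all_order all_algebra.
From mathcomp Require boolp classical_sets.
Set Implicit Arguments.
Unset Strict Implicit.
Unset Printing Implicit Defensive.
Import GRing.Theory.
Local Open Scope ring_scope.

(* The space of finitely supported sequences over F_p.  A polynomial is used
   only as its sequence of coefficients: the i-th standard coordinate of x is
   x`_i and the standard basis vector e_i is 'X^i. *)
Notation fsseq p := {poly 'F_p}.

Section Lexicodes.

Variable p : nat.
Local Notation V := (fsseq p).

Definition hamming (x y : V) : nat :=
  (\sum_(i < maxn (size x) (size y)) (x`_i != y`_i)%R)%N.

Definition std_basis : nat -> V := fun i => 'X^i.

Definition twisted_basis (xi eta : nat) : nat -> V :=
  fun i => if i == xi then 'X^xi + 'X^eta else 'X^i.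

Definition basis_family (F : nat -> V) : Prop :=
  F = std_basis \/
  exists xi eta : nat, xi <> eta /\ F = twisted_basis xi eta.

Definition lincomb (F : nat -> V) (c : V) : V :=
  \sum_(i < size c) c`_i *: F i.

(* c and c' are the F-coordinates of x and y (unique when F is a basis), and
   N is the largest index at which they differ. *)
Definition lex_lt (F : nat -> V) (x y : V) : Prop :=
  exists c c' : V, [/\ x = lincomb F c, y = lincomb F c' &
    exists N : nat, ((c`_N)%R < (c'`_N)%R)%N /\
      forall i : nat, (N < i)%N -> c`_i = c'`_i].

Definition is_lex_min (F : nat -> V) (P : V -> Prop) (z : V) : Prop :=
  P z /\ forall y : V, P y -> y <> z -> lex_lt F z y.

(* The exponent of a power of p equal to a is smaller than a, if 1 < p. *)
Definition is_power (a : nat) : bool := [exists i : 'I_a, a == p ^ i :> nat]%N.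

Definition digit (a i : nat) : 'F_p := ((a %/ p ^ i) %% p)%:R.

(* w^-(a) as a function of the list s of the words w^-(b), 0 <= b < a.  When F
   is in the family and p is prime, a unique minimum exists, so the default 0
   of xget is not used.  The digits of a at positions i >= a are 0. *)
Definition wnext (F : nat -> V) (d : nat) (s : seq V) : V :=
  let a := size s in
  if is_power a then
    classical_sets.xget 0
      (is_lex_min F (fun z => forall b, (b < a)%N -> (d <= hamming z s`_b)%N))
  else \sum_(i < a) digit a i *: s`_(p ^ i).

Fixpoint wseq (F : nat -> V) (d n : nat) : seq V :=
  if n is m.+1 then rcons (wseq F d m) (wnext F d (wseq F d m)) else [::].

Definition wminus (F : nat -> V) (d a : nat) : V := wnext F d (wseq F d a).

Lemma size_wseq F d n : size (wseq F d n) = n.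
Proof. by elim: n => //= n IHn; rewrite size_rcons IHn. Qed.

Lemma nth_wseq F d n b : (b < n)%N -> (wseq F d n)`_b = wminus F d b.
Proof.
elim: n => // n IHn; rewrite ltnS leq_eqVlt /= nth_rcons size_wseq.
by case/orP => [/eqP-> | lt_bn]; rewrite ?ltnn ?eqxx // lt_bn IHn.
Qed.

Lemma wminus_power F d a : is_power a ->
  wminus F d a = classical_sets.xget 0
    (is_lex_min F
      (fun z => forall b, (b < a)%N -> (d <= hamming z (wminus F d b))%N)).
Proof.
move=> pow_a; rewrite {1}/wminus /wnext size_wseq pow_a.
congr (classical_sets.xget _ (is_lex_min _ _)); apply: boolp.funext => z; apply: boolp.propext.
by split=> dist_z b lt_ba; move: (dist_z b lt_ba); rewrite nth_wseq.
Qed.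

Lemma wminus_sum F d a : prime p -> ~~ is_power a ->
  wminus F d a = \sum_(i < a) digit a i *: wminus F d (p ^ i).
Proof.
move=> p_prime pow'a; rewrite {1}/wminus /wnext size_wseq (negPf pow'a).
apply: eq_bigr => i _; have [lt_pia | le_api] := ltnP (p ^ i) a.
  by rewrite nth_wseq.
rewrite /digit divn_small ?mod0n ?scale0r // ltn_neqAle le_api andbT.
by apply: contra pow'a => a_pi; apply/existsP; exists i.
Qed.

Definition Lexminus (F : nat -> V) (d m : nat) : seq V :=
  mkseq (wminus F d) (p ^ m).

(* The coordinates at which some element of L is nonzero, in increasing
   order. *)
Definition active (L : seq V) : seq nat :=
  [seq i <- iota 0 (\max_(x <- L) size x) | has (fun x : V => x`_i != 0) L].

Definition Res (L : seq V) : {set 'rV['F_p]_(size (active L))} :=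
  [set:: [seq \row_j x`_(nth 0%N (active L) j) | x : V <- L]].

End Lexicodes.

Section Codes.

Variable p : nat.

Definition row_hamming n (x y : 'rV['F_p]_n) : nat :=
  #|[set j | x 0 j != y 0 j]|.

Definition is_min_distance n (C : {set 'rV['F_p]_n}) (d : nat) : Prop :=
  (forall x y, x \in C -> y \in C -> x != y -> (d <= row_hamming x y)%N) /\
  exists x y, [/\ x \in C, y \in C, x != y & row_hamming x y = d].

Definition is_linear_of_dim n (C : {set 'rV['F_p]_n}) (m : nat) : Prop :=
  exists U : {vspace 'rV['F_p]_n}, \dim U = m /\ C =i U.

(* C is an [n, m, d] code; its length is the dimension N of its ambient
   space. *)
Definition is_nmd_code N (C : {set 'rV['F_p]_N}) (n m d : nat) : Prop :=
  [/\ N = n, is_linear_of_dim C m & is_min_distance C d].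

Definition is_generator_matrix n m
    (C : {set 'rV['F_p]_n}) (G : 'M['F_p]_(m, n)) : Prop :=
  row_free G /\ forall x : 'rV['F_p]_n, (x \in C) = (x <= G)%MS.

(* A point of the projective space is a line P, i.e. \dim P = 1; the second
   conjunct requires the columns to be nonzero.  The subtraction in the last
   conjunct is not truncated, by the preceding one. *)
Definition is_Solomon_Stiffler n (C : {set 'rV['F_p]_n}) (m : nat) : Prop :=
  exists G : 'M['F_p]_(m, n),
  [/\ is_generator_matrix C G,
      forall j, col j G != 0 &
      exists (s t : nat) (U : 'I_t -> {vspace 'cV['F_p]_m}),
      [/\ forall i, U i != fullv,
          forall e : nat, (#|[set i | \dim (U i) == e]| <= p - 1)%N,
          forall P : {vspace 'cV['F_p]_m}, \dim P = 1%N ->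
            (#|[set i | (P <= U i)%VS]| <= s)%N &
          forall P : {vspace 'cV['F_p]_m}, \dim P = 1%N ->
            #|[set j | <[col j G]>%VS == P]|
              = (s - #|[set i | (P <= U i)%VS]|)%N]].

End Codes.

(* Main.v *)
(* Put u = pq + r.  Averaging over the codewords shows that a word at distance at
   least d from the span of the first m words needs at least ceil(d / p^m) new
   coordinates; the bound is attained by spreading its values evenly over the
   coordinates proportional to each projective point.  Minimality for <_F forces
   the bound to be met exactly: otherwise giving up one new coordinate yields a
   smaller word.  The only obstruction is that in the basis F(xi, eta) the
   coordinate eta comes for free with xi; it is harmless because at least 3 new
   coordinates are needed at every step, q + 1 >= 3 of them at the last one.
   Hence for m <= k all nonzero words have weight d, and the code is a multiple
   of a simplex code, by inverting the point-hyperplane incidences.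

   For the last word z let f(a) be the distance from z to the word with
   coefficient vector a, minus d.  Counting gives that f sums to (p-r)p^(k-1)
   over F_p^k and to (q+1-M)p^(k-1) over each affine hyperplane, M being the
   multiplicity of a point among the columns.  By a form of Ward's divisibility
   theorem p^(k-1) divides f, and f / p^(k-1) is the multiset of the p-r
   hyperplanes removed from q+1 copies of the projective space. *)
Require Import Defs.
From mathcomp Require Import all_boot all_order all_algebra all_field.
From mathcomp Require Import zify ring.
From mathcomp Require boolp classical_sets.
Set Implicit Arguments.
Unset Strict Implicit.
Unset Printing Implicit Defensive.
Import GRing.Theory.
Local Open Scope ring_scope.

(** * Divisibility of weights on affine spaces *)

Section PlaneVanishing.

Variables (p : nat) (p_prime : prime p).
Local Notation K := 'F_p.

Lemma poly_all_roots_eq0 (P : {poly K}) :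
  (size P <= p)%N -> (forall x, P.[x] = 0) -> P = 0.
Proof.
move=> szP rootP0; apply/eqP; apply: contraTT szP => nzP; rewrite -ltnNge.
have := max_poly_roots nzP (rs := enum K) _ (enum_uniq _).
rewrite -cardE card_Fp //; apply; apply/allP => x _; exact/eqP.
Qed.

Lemma bin_Fp_neq0 n i : (n < p)%N -> (i <= n)%N -> 'C(n, i)%:R != 0 :> K.
Proof.
move=> lt_np le_in; rewrite -(dvdn_pcharf (pchar_Fp p_prime)).
apply/negP => dv; have : (p %| n`!)%N.
  by rewrite -(bin_fact le_in) dvdn_mulr.
have fact_ndvd : forall m, (m < p)%N -> ~~ (p %| m`!)%N.
  elim=> [|m IHm] lt_mp; first by rewrite fact0 dvdn1 neq_ltn prime_gt1 ?orbT.
  rewrite factS Euclid_dvdM // negb_or IHm ?(ltnW lt_mp) // andbT.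
  by rewrite gtnNdvd.
by apply/negP; apply: fact_ndvd.
Qed.

(** By Fermat, x - u times the sum is x^p - u^p = x - u. For x = u all p terms are equal and the sum
    vanishes. This writes the delta function at u as a polynomial in x whose coefficients are powers
    of u. *)
Lemma sum_expr_Fp (x u : K) :
  \sum_(i < p) x ^+ (p.-1 - i) * u ^+ i = 1 - (x == u)%:R.
Proof.
have p_gt0 := prime_gt0 p_prime.
have pE (y : K) : y ^+ p = y by have := expf_card y; rewrite card_Fp.
have [<-|ne_xu] := eqVneq x u.
  rewrite (eq_bigr (fun=> x ^+ p.-1)) => [|i _]; last first.
    by rewrite -exprD subnK // -ltnS prednK.
  rewrite sumr_const card_ord subrr.
  by rewrite (mulrn_pchar (pchar_Fp p_prime)).
rewrite subr0; apply: (mulfI (x := x - u)); rewrite ?subr_eq0 //.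
by rewrite -subrXX !pE mulr1.
Qed.

Variable f : K -> K -> K.

Let S i j := \sum_s \sum_t f s t * (s ^+ i * t ^+ j).

Hypothesis f_line : forall m c, \sum_s f s (m * s + c) = 0.

Lemma line_power_sum m n : \sum_s \sum_t f s t * (t - m * s) ^+ n = 0.
Proof.
transitivity (\sum_s \sum_c f s (m * s + c) * c ^+ n).
  apply: eq_bigr => s _; rewrite (reindex_inj (addrI (m * s))) /=.
  by apply: eq_bigr => c _; rewrite [_ + c]addrC addrK.
rewrite exchange_big big1 //= => c _.
by rewrite -mulr_suml f_line mul0r.
Qed.

(** For n = i + j < p, the sum in [line_power_sum] is a polynomial in m of degree at most n that
    vanishes on all of K, hence is 0. Its coefficients are moments times signed binomials, which are
    invertible modulo p. *)
Lemma moment_eq0 i j : (i + j < p)%N -> S i j = 0.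
Proof.
move=> lt_p; set n := (i + j)%N.
pose P := \poly_(l < n.+1) ((-1) ^+ l * S l (n - l) *+ 'C(n, l)) : {poly K}.
have P0 : P = 0.
  apply: poly_all_roots_eq0 => [|m]; first exact: leq_trans (size_poly _ _) _.
  rewrite horner_poly -[RHS](line_power_sum m n).
  under [RHS]eq_bigr => s _ do under eq_bigr => t _ do
    rewrite exprBn mulr_sumr.
  rewrite /S; under [RHS]eq_bigr => s _ do rewrite exchange_big.
  rewrite [RHS]exchange_big; apply: eq_bigr => l _ /=.
  rewrite -mulrnAl mulrAC mulr_sumr.
  apply: eq_bigr => s _; rewrite mulr_sumr; apply: eq_bigr => t _ /=.
  rewrite exprMn mulrnAl mulrnAr mulrnAl; congr (_ *+ _); ring.
have := congr1 (fun q : {poly K} => q`_i) P0.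
rewrite coef_poly coef0 ltnS leq_addr /n addKn -mulr_natl => /eqP.
rewrite !mulf_eq0 (negPf (bin_Fp_neq0 _ _)) ?leq_addr //= signr_eq0 /=.
by move/eqP.
Qed.

Hypothesis zero_line : forall m, exists c, forall s, f s (m * s + c) = 0.

(* Vanishing line sums make f a polynomial of total degree at most p - 2.  As a
   polynomial in its second variable it has the p distinct roots mX + c given by
   the zero lines, so it is 0. *)
Lemma plane_fun_eq0 s t : f s t = 0.
Proof.
have p_gt0 := prime_gt0 p_prime.
(* Interpolation: both delta functions are expanded by [sum_expr_Fp]. The terms in which a factor
   contributes its constant 1 are moments with an index 0, and [moment_eq0] kills them. *)
have f_moments x y : f x y =
    \sum_(j < p) (\sum_(i < p) S i j * x ^+ (p.-1 - i)) * y ^+ (p.-1 - j).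
  transitivity (\sum_u \sum_v f u v * ((x == u)%:R * (y == v)%:R)).
    rewrite (bigD1 x) //= [X in _ + X]big1 => [|u /negPf ne]; last first.
      by rewrite big1 // => v _; rewrite eq_sym ne mul0r mulr0.
    rewrite (bigD1 y) //= [X in (_ + X) + _]big1 => [|v /negPf ne]; last first.
      by rewrite [y == v]eq_sym ne !mulr0.
    by rewrite !eqxx !mulr1 !addr0.
  have dE (z w : K) : (z == w)%:R = 1 - \sum_(i < p) z ^+ (p.-1 - i) * w ^+ i.
    by rewrite sum_expr_Fp opprB addrC subrK.
  pose T i j u v := f u v * (u ^+ i * v ^+ j).
  have TE i j : \sum_u \sum_v T i j u v = S i j by [].
  transitivity (\sum_u \sum_v (T 0 0 u v
      - \sum_(i < p) x ^+ (p.-1 - i) * T i 0 u v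
      - \sum_(j < p) y ^+ (p.-1 - j) * T 0 j u v
      + \sum_(j < p) \sum_(i < p) x ^+ (p.-1 - i) * y ^+ (p.-1 - j) * T i j u
        v)).
    apply: eq_bigr => u _; apply: eq_bigr => v _; rewrite !dE.
    set A := \sum_(i < p) x ^+ _ * _; set B := \sum_(i < p) y ^+ _ * _.
    have -> : \sum_(i < p) x ^+ (p.-1 - i) * T i 0%N u v = f u v * A.
      by rewrite mulr_sumr; apply: eq_bigr => i _; rewrite /T; ring.
    have -> : \sum_(j < p) y ^+ (p.-1 - j) * T 0%N j u v = f u v * B.
      by rewrite mulr_sumr; apply: eq_bigr => j _; rewrite /T; ring.
    have -> : \sum_(j < p) \sum_(i < p)
        x ^+ (p.-1 - i) * y ^+ (p.-1 - j) * T i j u v = f u v * (A * B).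
      rewrite mulr_sumr mulr_sumr; apply: eq_bigr => j _.
      by rewrite mulr_suml mulr_sumr; apply: eq_bigr => i _; rewrite /T; ring.
    by rewrite /T; ring.
  have exch (w : 'I_p -> K) (a b : 'I_p -> nat) :
      \sum_u \sum_v \sum_(i < p) w i * T (a i) (b i) u v
        = \sum_(i < p) w i * S (a i) (b i).
    under eq_bigr => u _ do rewrite exchange_big.
    rewrite exchange_big; apply: eq_bigr => i _ /=.
    by under eq_bigr => u _ do rewrite -mulr_sumr; rewrite -mulr_sumr.
  under eq_bigr => u _ do rewrite big_split /= !sumrB.
  rewrite big_split /= !sumrB TE.
  rewrite (exch (fun i => x ^+ (p.-1 - i)) (fun i => i) (fun=> 0%N)).
  rewrite (exch (fun i => y ^+ (p.-1 - i)) (fun=> 0%N) (fun i => i)).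
  rewrite moment_eq0 // [X in 0 - X]big1 => [|i _]; last first.
    by rewrite moment_eq0 ?mulr0 // addn0.
  rewrite [X in _ - X]big1 => [|i _];
    last by rewrite moment_eq0 ?mulr0 ?add0n ?ltn_ord.
  rewrite !subr0 add0r.
  under eq_bigr => u _ do rewrite exchange_big.
  rewrite exchange_big; apply: eq_bigr => j _ /=.
  rewrite (exch (fun i => x ^+ (p.-1 - i) * y ^+ (p.-1 - j)) (fun i => i)
    (fun=> j)).
  by rewrite mulr_suml; apply: eq_bigr => i _; ring.
pose c j : {poly K} := \sum_(i < p) S i j *: 'X^(p.-1 - i).
pose Q : {poly {poly K}} := \sum_(j < p) c j *: 'X^(p.-1 - j).
(* A nonzero moment [S i j] has i + j >= p, so the exponent p - 1 - i is below j. *)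
have sz_c j : (j < p)%N -> (size (c j) <= j)%N.
  move=> lt_jp; apply: (leq_trans (size_sum _ _ _)); apply/bigmax_leqP => i _.
  have [lt_ij|le_ij] := ltnP (i + j) p.
    by rewrite moment_eq0 // scale0r size_poly0.
  apply: leq_trans (size_scale_leq _ _) _; rewrite size_polyXn;
    have := ltn_ord i; lia.
have Q0 : Q = 0.
  have [Q0|nzQ] := eqVneq Q 0 => //.
  have zlP m : exists c, [forall s, f s (m * s + c) == 0].
    by have [c' c'P] := zero_line m; exists c'; apply/forallP => x; apply/eqP.
  pose zl m := m *: 'X + (xchoose (zlP m))%:P : {poly K}.
  have zl_root m : root Q (zl m).
    (* The value of [Q] at [zl m] is a polynomial of degree below p; at each x in K it is the value
       of f on the zero line of slope m. *)
    apply/rootP; apply: poly_all_roots_eq0 => [|x].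
      rewrite /Q horner_sum; apply: (leq_trans (size_sum _ _ _)).
      apply/bigmax_leqP => j _; rewrite hornerZ hornerXn.
      apply: leq_trans (size_polyMleq _ _) _.
      have : (size (zl m ^+ (p.-1 - j)) <= (p.-1 - j).+1)%N.
        apply: leq_trans (size_poly_exp_leq _ _) _.
        have : (size (zl m) <= 2)%N.
          rewrite (leq_trans (size_polyD _ _)) // geq_max.
          rewrite (leq_trans (size_scale_leq _ _)) ?size_polyX //.
          exact: leq_trans (size_polyC_leq1 _) _.
        nia.
      move=> sz_exp; rewrite -subn1 leq_subLR;
        apply: leq_trans (leq_add (sz_c j (ltn_ord j)) sz_exp) _.
      have := ltn_ord j; lia.
    have /forallP/(_ x)/eqP <- := xchooseP (zlP m).
    rewrite f_moments /Q !horner_sum.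
    apply: eq_bigr => j _; rewrite !hornerE /c horner_sum; congr (_ * _).
    by apply: eq_bigr => i _; rewrite !hornerE.
  have zl_inj : injective zl.
    move=> m m' /(congr1 (fun q : {poly K} => q`_1)).
    by rewrite /zl !coefD !coefZ !coefX !coefC /= !addr0 !mulr1.
  have := max_poly_roots nzQ (rs := map zl (enum K)).
  rewrite size_map -cardE card_Fp // map_inj_uniq ?enum_uniq //.
  have szQ : (size Q <= p)%N.
    apply: (leq_trans (size_sum _ _ _)); apply/bigmax_leqP => j _.
    apply: leq_trans (size_scale_leq _ _) _; rewrite size_polyXn; lia.
  have rts : all (root Q) [seq zl m | m <- enum K].
    by apply/allP => _ /mapP[m _ ->]; exact: zl_root.
  by move=> /(_ rts isT); rewrite ltnNge szQ.
have S0 i j : (i < p)%N -> (j < p)%N -> S i j = 0.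
  move=> lt_ip lt_jp.
  have := congr1 (fun q : {poly {poly K}} => q`_(p.-1 - j)`_(p.-1 - i)) Q0.
  rewrite !coef0 /Q coef_sum (bigD1 (Ordinal lt_jp)) //= big1 => [|j' ne].
    rewrite addr0 coefZ coefXn eqxx mulr1 /c coef_sum.
    rewrite (bigD1 (Ordinal lt_ip)) //= big1 => [|i' ne].
      by rewrite addr0 coefZ coefXn eqxx mulr1.
    rewrite coefZ coefXn; case: eqP => [e|]; last by rewrite mulr0.
    by case/eqP: ne; apply/val_inj => /=; have := ltn_ord i'; lia.
  rewrite coefZ coefXn; case: eqP => [e|]; last by rewrite mulr0.
  by case/eqP: ne; apply/val_inj => /=; have := ltn_ord j'; lia.
by rewrite f_moments big1 // => j _; rewrite big1 ?mul0r // => i _;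
  rewrite S0 // mul0r.
Qed.

End PlaneVanishing.

Section Dot.

Variables (F : comPzRingType) (m : nat).
Implicit Types (a : 'rV[F]_m) (v : 'cV[F]_m).

Definition dot a v : F := (a *m v) 0 0.

Lemma dotE a v : dot a v = \sum_i a 0 i * v i 0.
Proof. by rewrite /dot mxE. Qed.

Lemma dotDl a b v : dot (a + b) v = dot a v + dot b v.
Proof. by rewrite /dot mulmxDl [LHS]mxE. Qed.

Lemma dotBl a b v : dot (a - b) v = dot a v - dot b v.
Proof. by rewrite /dot mulmxBl [LHS]mxE [X in _ + X]mxE. Qed.

Lemma dotZl c a v : dot (c *: a) v = c * dot a v.
Proof. by rewrite /dot -scalemxAl [LHS]mxE. Qed.

Lemma dotBr a v w : dot a (v - w) = dot a v - dot a w.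
Proof. by rewrite /dot mulmxBr [LHS]mxE [X in _ + X]mxE. Qed.

Lemma dotZr c a v : dot a (c *: v) = c * dot a v.
Proof. by rewrite /dot -scalemxAr [LHS]mxE. Qed.

Lemma dot0l v : dot 0 v = 0.
Proof. by rewrite /dot mul0mx mxE. Qed.

Lemma dot0r a : dot a 0 = 0.
Proof. by rewrite /dot mulmx0 mxE. Qed.

Lemma dot_delta a i : dot a (delta_mx i 0) = a 0 i.
Proof. by rewrite /dot -colE mxE. Qed.

End Dot.

Section Divisibility.

Variables (p : nat) (p_prime : prime p).
Local Notation K := 'F_p.

(* In each direction the p line sums are multiples of p^e with total less than
   p^(e+1), so one of them is 0: this provides the zero lines modulo p. *)
Lemma plane_weights_dvdn e (f : K -> K -> nat) :
  (forall m c, p ^ e %| \sum_s f s (m * s + c)%R)%N ->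
  (\sum_s \sum_t f s t < p ^ e.+1)%N ->
  forall s t, (p ^ e %| f s t)%N.
Proof.
have p_gt0 := prime_gt0 p_prime.
elim: e f => [|e IHe] f f_line f_lt s t; first exact: dvd1n.
have Fp_eq0 n : (n%:R == 0 :> K) = (p %| n)%N.
  by rewrite (dvdn_pcharf (pchar_Fp p_prime)).
have p_f x y : (p %| f x y)%N.
  rewrite -Fp_eq0; apply/eqP.
  apply: (plane_fun_eq0 p_prime (f := fun x y => (f x y)%:R)) => [m c | m].
    apply/eqP; rewrite -natr_sum Fp_eq0.
    by apply: dvdn_trans (f_line m c); rewrite expnS dvdn_mulr.
  have : [exists c, \sum_s f s (m * s + c)%R == 0]%N.
    apply: contraTT f_lt; rewrite negb_exists -leqNgt => /forallP nz.
    have -> : (\sum_s \sum_t f s t = \sum_c \sum_s f s (m * s + c)%R)%N.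
      rewrite [RHS]exchange_big /=.
      by apply: eq_bigr => x' _; rewrite (reindex_inj (addrI (m * x'))).
    have -> : (p ^ e.+2 = \sum_(c : K) p ^ e.+1)%N.
      by rewrite sum_nat_const card_Fp // expnS.
    by apply: leq_sum => c _; rewrite dvdn_leq // lt0n.
  case/existsP => c; rewrite sum_nat_eq0 => /forallP c0; exists c => x'.
  by have /= /eqP-> := c0 x'.
have fE x y : f x y = (p * (f x y %/ p))%N by rewrite mulnC divnK.
rewrite fE expnS dvdn_pmul2l //.
apply: (IHe (fun x y => f x y %/ p)%N) => [m c|].
  rewrite -(dvdn_pmul2l p_gt0) -expnS big_distrr /=.
  by under eq_bigr => x _ do rewrite -fE.
rewrite -(ltn_pmul2l p_gt0) -expnS big_distrr /=.
by under eq_bigr => x _ do [rewrite big_distrr /=;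
  under eq_bigr => y _ do rewrite -fE].
Qed.

Variables (k e : nat) (f : 'rV[K]_k -> nat).

Hypothesis hyperplane_dvd : forall v t, v != 0 ->
  (p ^ e %| \sum_(a | dot a v == t) f a)%N.
Hypothesis total_lt : (\sum_a f a < p ^ e.+1)%N.

Let prefix j (a0 a : 'rV[K]_k) :=
  [forall i : 'I_k, (i < j)%N ==> (a 0 i == a0 0 i)].

(* Fixing one more coordinate of a flat: the sums of f over the fibres of
   (a_j, a.v) are weights on a plane whose lines are flats of the previous
   kind. *)
Lemma flat_dvd j a0 (v : 'cV[K]_k) t :
  (exists2 i : 'I_k, (j <= i)%N & v i 0 != 0) ->
  (p ^ e %| \sum_(a | prefix j a0 a && (dot a v == t)) f a)%N.
Proof.
elim: j v t => [|j IHj] v t [i le_ji vi].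
  rewrite (eq_bigl (fun a => dot a v == t)) => [|a].
    by apply: hyperplane_dvd; apply: contraNneq vi => ->; rewrite mxE.
  by rewrite (_ : prefix 0 a0 a) //; apply/forallP.
pose oj : 'I_k := Ordinal (ltn_trans le_ji (ltn_ord i)).
pose g x y := (\sum_(a | [&& prefix j a0 a, a 0%R oj == x & dot a v == y]) f
  a)%N.
have -> : (\sum_(a | prefix j.+1 a0 a && (dot a v == t)) f a = g (a0 0%R oj)
  t)%N.
  apply: eq_bigl => a; rewrite andbA; congr (_ && _).
  apply/forallP/andP => [pre | [/forallP pre a_j] l].
    split; last exact: (implyP (pre oj)).
    by apply/forallP => l; apply/implyP => lt_lj; apply: (implyP (pre l));
      apply: leqW.
  apply/implyP; rewrite ltnS leq_eqVlt => /orP[/eqP e_lj|]; last exact/implyP.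
  by rewrite (_ : l = oj) //; apply: val_inj.
apply: plane_weights_dvdn => [m c|].
  (* A line y = m x + c of the plane is the set where a.(v - m e_j) = c. The i-th entry of that
     vector is still v_i, because i > j. *)
  rewrite /g [X in (_ %| X)%N](_ : _ =
     (\sum_(a | prefix j a0 a && (dot a (v - m *: delta_mx oj 0)%R == c)) f
       a)%N).
    apply: IHj; exists i; first exact: ltnW.
    rewrite !mxE (_ : (i == oj) = false) /= ?mulr0 ?subr0 //.
    by apply/negbTE; rewrite neq_ltn /= le_ji orbT.
  rewrite [RHS](partition_big (fun a : 'rV_k => a 0 oj) predT) //=.
  apply: eq_bigr => x _; apply: eq_bigl => a.
  rewrite [RHS]andbAC -[RHS]andbA; congr (_ && _).
  case: eqP => //= <-; rewrite dotBr dotZr dot_delta.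
  by rewrite subr_eq addrC.
rewrite /g; apply: leq_ltn_trans total_lt.
rewrite [leqRHS](bigID (prefix j a0)) /=; apply: leq_trans (leq_addr _ _).
rewrite [leqRHS](partition_big (fun a : 'rV_k => a 0 oj) predT) //=.
apply: leq_sum => x _.
rewrite [leqRHS](partition_big (fun a => dot a v) predT) //=.
by apply: leq_sum => y _; under eq_bigl => a do rewrite andbA.
Qed.

(** Fixing the first k - 1 coordinates and the product with the last unit vector leaves a flat of
    [flat_dvd] that is the single point a. *)
Theorem weights_dvdn a : (0 < k)%N -> (p ^ e %| f a)%N.
Proof.
case: k f hyperplane_dvd total_lt a @prefix flat_dvd => // k' f' _ _ a pre flat
  _.
have := flat k' a (delta_mx ord_max 0) (a 0 ord_max).
rewrite (big_pred1 a) => [|a'].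
  by apply; exists ord_max; rewrite // mxE !eqxx oner_eq0.
rewrite /= dot_delta.
apply/andP/eqP => [[/forallP a_pre /eqP a_max] | ->]; last first.
  by split=> //; apply/forallP => l; apply/implyP.
apply/rowP => l; have [lt_l|] := ltnP l k'; first exact/eqP/(implyP (a_pre l)).
move=> le_l; rewrite (_ : l = ord_max) //; apply: val_inj => /=.
by apply/eqP; rewrite eqn_leq le_l -ltnS ltn_ord.
Qed.

End Divisibility.

(** * Counting distances to a linear code *)

Lemma card_fiber (U V : finZmodType) (h : U -> V) t :
  {morph h : x y / x + y} -> (forall s, exists a, h a = s) ->
  (#|[pred a | h a == t]| * #|V| = #|U|)%N.
Proof.
move=> hD h_surj.
have fib s : #|[pred a | h a == s]| = #|[pred a | h a == t]|.
  have [a0 ha0] := h_surj (s - t).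
  rewrite -!sum1_card (reindex_inj (addIr a0)) /=; apply: eq_bigl => a.
  by rewrite !inE hD ha0 addrCA -[RHS]subr_eq0 -[X in _ == X]addr0 (inj_eq
    (addrI s)).
rewrite -[RHS]sum1_card (partition_big h predT) //= mulnC -sum_nat_const.
by apply: eq_bigr => s _; rewrite -(fib s) -sum1_card.
Qed.

Section Counting.

Variable F : finFieldType.
Local Notation q := #|F|.

Section FixedDim.

Variable m : nat.
Implicit Types (a : 'rV[F]_m) (v w : 'cV[F]_m).

Lemma dot_surj v : v != 0 -> forall t, exists a, dot a v = t.
Proof.
case/cV0Pn=> i vi t; exists ((t / v i 0) *: delta_mx 0 i).
rewrite dotZl /dot -rowE mxE divfK //.
Qed.

Lemma card_dot v t :
  v != 0 -> (q * #|[pred a | dot a v == t]| = q ^ m)%N.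
Proof.
move=> nz_v; rewrite mulnC (card_fiber t _ (dot_surj nz_v)) => [|a b].
  by rewrite card_mx mul1n.
exact: dotDl.
Qed.

Definition in_line v w := [exists l, v == l *: w].

Lemma dot_surj2 v w : w != 0 -> ~~ in_line v w ->
  forall s t, exists a, dot a v = s /\ dot a w = t.
Proof.
case/cV0Pn=> i wi nl_v s t.
(* Eliminating coordinate i of v by means of w leaves a nonzero entry x at some j; up to sign w_i x
   is the minor of v and w at i and j, so the two equations can be solved on these coordinates. *)
have /cV0Pn[j] : v - (v i 0 / w i 0) *: w != 0.
  by apply: contra nl_v; rewrite subr_eq0 => vE; apply/existsP;
    exists (v i 0 / w i 0).
rewrite !mxE => xj; set x := _ - _ in xj.
pose y := (s - t * (v i 0 / w i 0)) / x.
exists (((t - y * w j 0) / w i 0) *: delta_mx 0 i + y *: delta_mx 0 j).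
rewrite !dotDl !dotZl /dot -!rowE !mxE.
split; last by field.
have -> : v j 0 = x + v i 0 / w i 0 * w j 0 by rewrite /x subrK.
have -> : y * (x + v i 0 / w i 0 * w j 0) = s - t * (v i 0 / w i 0) + y * (v i
  0 / w i 0 * w j 0).
  by rewrite mulrDr /y divfK.
by field.
Qed.

Lemma card_dot2 v w s t : w != 0 -> ~~ in_line v w ->
  (q ^ 2 * #|[pred a | (dot a w == t) && (dot a v == s)]| = q ^ m)%N.
Proof.
move=> nz_w nl_v; rewrite mulnC.
pose h a : 'rV[F]_(1 + 1) := row_mx (a *m w) (a *m v).
have hE a s' t' : (h a == row_mx t'%:M s'%:M) = (dot a w == t') && (dot a v ==
  s').
  apply/eqP/andP => [/eq_row_mx[e1 e2]|[/eqP <- /eqP <-]].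
    by rewrite /dot e1 e2 !mxE !eqxx.
  by rewrite /h -!mx11_scalar.
rewrite -(_ : #|{: 'rV[F]_m}| = q ^ m)%N; last by rewrite card_mx mul1n.
rewrite -(@card_fiber _ _ h (row_mx t%:M s%:M)) => [|a b|y].
- by rewrite card_mx; congr (_ * _)%N; apply: eq_card => a; rewrite !inE hE.
- by rewrite /h !mulmxDl add_row_mx.
have [a [av aw]] := dot_surj2 nz_w nl_v (rsubmx y 0 0) (lsubmx y 0 0).
by exists a; apply/eqP;
  rewrite -[y]hsubmxK [lsubmx y]mx11_scalar [rsubmx y]mx11_scalar hE av aw
  !eqxx.
Qed.

(** For v nonzero, a.v takes every value equally often; for v = 0 the coordinate differs always or
    never. The factor q avoids division in [nat]. *)
Lemma sum_neq_dot v z :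
  (q * \sum_a (z != dot a v)
     = q ^ m * (q * ((v == 0%R) && (z != 0%R)) + (q - 1) * (v != 0%R)))%N.
Proof.
have [->|nz_v] := eqVneq v 0.
  under eq_bigr => a _ do rewrite dot0r.
  by rewrite sum_nat_const card_mx mul1n mulnCA muln0 addn0.
rewrite muln0 add0n muln1.
have := card_dot z nz_v;
  rewrite -[#|[pred a | dot a v == z]|]sum1_card big_mkcond /=.
have : (\sum_(a : 'rV[F]_m) 1 = q ^ m)%N by rewrite sum1_card card_mx mul1n.
have -> : (\sum_(a : 'rV[F]_m) 1 = \sum_a (z != dot a v)
    + \sum_a (if a \in [pred a | dot a v == z] then 1 else 0))%N.
  by rewrite -big_split; apply: eq_bigr => a _; rewrite !inE eq_sym; case: eqP.
by move=> AB qB; rewrite mulnBr muln1 -{1}AB -qB mulnDl [X in (_ + X)%N]mulnC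
  addnK mulnC.
Qed.

(** The extended column (v; z) lies on the line through (w; t): for v and w nonzero, both represent
    the same projective point. *)
Definition in_graph_line v z w t :=
  [exists l, (v == l *: w) && (z == l * t)].

(** On the hyperplane a.w = t, the product a.v is constant if v is a multiple of w and
    equidistributed otherwise. The columns agreeing with z on the whole hyperplane are counted on
    the left to avoid a subtraction. *)
Lemma sum_neq_dot_hyperplane v w z t : w != 0 ->
  (q ^ 2 * (\sum_(a | dot a w == t) (z != dot a v))
     + q ^ m * (q * ((v != 0%R) && in_graph_line v z w t))
  = q ^ m * (q * ((v == 0%R) && (z != 0%R)) + q * ((v != 0%R) && in_line v w)
       + (q - 1) * ((v != 0%R) && ~~ in_line v w)))%N.
Proof.
move=> nz_w; have cw := card_dot t nz_w.
have sumC n : (q ^ 2 * (\sum_(a | dot a w == t) n) = q ^ m * (q * n))%N.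
  by rewrite sum_nat_const -cw -mulnn -!mulnA; congr (_ * _)%N; rewrite mulnCA.
have [->|nz_v] := eqVneq v 0.
  rewrite /= !muln0 !addn0; under eq_bigr => a _ do rewrite dot0r.
  by rewrite sumC.
rewrite !andTb andFb !muln0 add0n.
have [/existsP[l /eqP vE]|nl] := boolP (in_line v w).
  have -> : in_graph_line v z w t = (z == l * t).
    apply/existsP/idP => [[l' /andP[/eqP vE' /eqP->]]|zE]; last first.
      by exists l; rewrite vE eqxx.
    have /eqP : (l' - l) *: w = 0 by rewrite scalerBl -vE -vE' subrr.
    by rewrite scaler_eq0 subr_eq0 (negPf nz_w) orbF => /eqP->.
  rewrite (eq_bigr (fun=> (z != l * t) : nat)) => [|a /eqP<-]; last first.
    by rewrite vE dotZr.
  by rewrite sumC -mulnDr; case: eqP => _ /=;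
    rewrite !(muln0, muln1, addn0, add0n).
have -> : in_graph_line v z w t = false.
  apply/negbTE/negP => /existsP[l /andP[vE _]]; case/negP: nl.
  by apply/existsP; exists l.
rewrite !muln0 addn0 add0n muln1 mulnBr muln1 -{2}(card_dot2 z t nz_w nl) -cw.
have -> : (#|[pred a | dot a w == t]| = \sum_(a | dot a w == t) (z != dot a v)
    + #|[pred a | (dot a w == t) && (dot a v == z)]|)%N.
  rewrite -[LHS]sum1_card -[X in (_ + X)%N]sum1_card [X in (_ +
    X)%N]big_mkcondr -big_split.
  by apply: eq_bigr => a _; rewrite eq_sym; case: eqP.
by rewrite mulnAC mulnn mulnDr addnK.
Qed.

End FixedDim.
End Counting.

Section Aggregate.

Variables (F : finFieldType) (m : nat) (J : finType).
Variables (v : J -> 'cV[F]_m) (z : J -> F).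
Local Notation q := #|F|.

Definition n_active := (\sum_j (v j != 0%R))%N.
Definition n_extra := (\sum_j ((v j == 0%R) && (z j != 0%R)))%N.
Definition word_dist (a : 'rV[F]_m) := (\sum_j (z j != dot a (v j)))%N.
Definition n_line w := (\sum_j ((v j != 0%R) && in_line (v j) w))%N.
Definition n_off_line w := (\sum_j ((v j != 0%R) && ~~ in_line (v j) w))%N.
Definition n_graph w t := (\sum_j ((v j != 0%R) && in_graph_line (v j) (z j) w
  t))%N.

Lemma n_line_add w : (n_line w + n_off_line w = n_active)%N.
Proof.
by rewrite -big_split; apply: eq_bigr => j _; case: eqP => //=; case: in_line.
Qed.

Lemma sum_word_dist :
  (q * \sum_a word_dist a = q ^ m * (q * n_extra + (q - 1) * n_active))%N.
Proof.
rewrite exchange_big big_distrr /=.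
under eq_bigr => j _ do rewrite sum_neq_dot.
by rewrite -big_distrr big_split /= -!big_distrr.
Qed.

Lemma sum_word_dist_hyperplane w t : w != 0 ->
  (q ^ 2 * (\sum_(a | dot a w == t) word_dist a) + q ^ m * (q * n_graph w t)
    = q ^ m * (q * n_extra + q * n_line w + (q - 1) * n_off_line w))%N.
Proof.
move=> nz_w; rewrite exchange_big /= /n_graph 2![in LHS]big_distrr /=.
rewrite [X in (_ + X)%N]big_distrr -big_split /=.
under eq_bigr => j _ do rewrite sum_neq_dot_hyperplane //.
by rewrite -big_distrr !big_split /= -!big_distrr.
Qed.

End Aggregate.

(** The weights on the hyperplane a.w = 0 sum to (q^(m-1) - 1) d. Expressed through the columns, the
    same sum involves only the length and [n_line v w], which is thereby determined. Constant weight
    thus forces all points to have the same multiplicity. *)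
Lemma constant_weight_line (F : finFieldType) m (J : finType) (v : J ->
  'cV[F]_m) d U :
  (forall a, a != 0 -> (\sum_j (dot a (v j) != 0%R) = d)%N) ->
  (U * #|F| ^ m = #|F| * d)%N ->
  ((#|F| - 1) * n_active v + U = #|F| * d)%N ->
  forall w, w != 0 -> n_line v w = U.
Proof.
move=> wt Um nU w nz_w; have q_gt1 : (1 < #|F|)%N by apply: finNzRing_gt1.
have /= := sum_word_dist_hyperplane v (fun=> 0) 0 nz_w.
have -> : n_extra v (fun=> 0) = 0%N.
  by rewrite /n_extra big1 // => j _; rewrite eqxx andbF.
have -> : n_graph v (fun=> 0) w 0 = n_line v w.
  apply: eq_bigr => j _; congr (_ && _ : nat); apply: eq_existsb => l.
  by rewrite mulr0 eqxx andbT.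
have := card_dot 0 nz_w; set H := #|[pred a | dot a w == 0]| => cH.
have -> : (\sum_(a | dot a w == 0%R) word_dist v (fun=> 0%R) a = (H - 1) * d)%N.
  rewrite (bigD1 0) /=; last by rewrite dot0l.
  rewrite [X in (X + _)%N]/word_dist big1 => [|j _]; last by rewrite dot0l eqxx.
  rewrite add0n (eq_bigr (fun=> d)) => [|a /andP[_ nz_a]].
    rewrite sum_nat_const; congr (_ * _)%N; rewrite /H.
    rewrite [in RHS](cardD1 (0 : 'rV[F]_m)).
    rewrite (_ : 0 \in _ = true) ?add1n ?subn1 /=;
      last by rewrite inE dot0l eqxx.
    by apply: eq_card => a; rewrite !inE andbC.
  by rewrite -(wt a nz_a); apply: eq_bigr => j _; rewrite eq_sym.
have := n_line_add v w; set N := n_line v w; set N' := n_off_line v w => nE.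
have H_gt0 : (0 < H)%N by apply/card_gt0P; exists 0; rewrite inE dot0l.
move: Um nU cH; rewrite -nE; case: H H_gt0 => // h _.
move: (#|F|) q_gt1 => q q_gt1; rewrite subSS subn0.
set Q := (q ^ m)%N => Um nU cH E.
have Q_gt0 : (0 < Q)%N by rewrite expn_gt0 (ltnW q_gt1).
have E' : (q ^ 2 * (h * d) = Q * ((q - 1) * N'))%N.
  apply: (@addIn (Q * (q * N))%N); rewrite E; ring.
have qd : (q * d = U * Q)%N by rewrite -Um.
have e1 : (Q * (q * h * U) = Q * ((q - 1) * N'))%N.
  rewrite -E' -mulnn.
  transitivity (q * h * (U * Q))%N; first ring.
  rewrite -qd; ring.
have e2 : (q * h * U = (q - 1) * N')%N by apply/eqP;
  rewrite -(eqn_pmul2l Q_gt0) e1.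
have e3 : ((q - 1) * N + (q - 1) * N' + U = U * (q * h.+1))%N.
  by rewrite -mulnDr nU qd -cH.
have e4 : ((q - 1) * N = (q - 1) * U)%N.
  move: e3; rewrite -e2; clear -q_gt1; case: q q_gt1 => // q _;
    rewrite subSS subn0; nia.
by apply/eqP; rewrite -(@eqn_pmul2l (q - 1)) ?subn_gt0 // e4.
Qed.

(** * Words spread evenly over each projective point *)

Section BalancedWord.

Variables (p : nat) (p_prime : prime p).
Local Notation K := 'F_p.

Lemma sum_succ_residue (t : K) : (\sum_(i < p) (i.+1%:R == t) = 1)%N.
Proof.
have inj : injective (fun i : 'I_p => i.+1%:R : K).
  move=> i i' /eqP; rewrite -Fp_nat_mod // -[X in _ == X]Fp_nat_mod //.
  move/eqP/(congr1 (fun x : K => nat_of_ord x)).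
  rewrite !val_Fp_nat // !modn_mod => /eqP.
  rewrite -addn1 -[in X in _ == X]addn1 eqn_modDr !modn_small // => /eqP.
  exact: val_inj.
have [|g fK gK] := inj_card_bij inj;
  first by rewrite (card_Fp p_prime) card_ord.
rewrite (bigD1 (g t)) //= gK eqxx big1 ?addn0 // => i ne.
by case: eqP => // e; case/eqP: ne; rewrite -e fK.
Qed.

(** The blocks of length s receive the values 1, ..., p. The c indices missing from p s all lie in
    the last block, whose value p is 0 in K. *)
Lemma sum_block_residue U c s (t : K) : (c <= s)%N -> (U + c = p * s)%N ->
  (\sum_(x < U) ((x %/ s).+1%:R == t) + c * (t == 0%R) = s)%N.
Proof.
have p_gt0 := prime_gt0 p_prime.
case: s => [|s] le_cs Uc.
  move: Uc le_cs; rewrite muln0 leqn0 => /eqP;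
    rewrite addn_eq0 => /andP[/eqP-> /eqP->].
  by rewrite big_ord0.
transitivity (\sum_(x < p * s.+1) ((x %/ s.+1).+1%:R == t))%N.
  rewrite -Uc big_split_ord /=; congr (_ + _)%N.
  rewrite (eq_bigr (fun=> (t == 0) : nat)) => [|x _].
    by rewrite sum_nat_const card_ord.
  rewrite (_ : (U + x) %/ s.+1 = p.-1)%N.
    by rewrite prednK // pcharf0 ?pchar_Fp // eq_sym.
  apply/eqP; rewrite eqn_leq -ltnS prednK // ltn_divLR // -Uc ltn_add2l ltn_ord.
  rewrite leq_divRL //.
  have : (p.-1 * s.+1 + s.+1 = U + c)%N by rewrite -mulSnr prednK.
  lia.
rewrite -(big_mkord xpredT (fun x => (x %/ s.+1).+1%:R == t : nat)).
rewrite big_nat_mul big_mkord -[RHS]muln1 -(sum_succ_residue t) big_distrr /=.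
apply: eq_bigr => i _;
  rewrite (eq_big_nat _ _ (F2 := fun=> (i.+1%:R == t) : nat)).
  by rewrite sum_nat_const_nat -mulnBl subSn // subnn mul1n.
move=> j /andP[le_j lt_j]; congr (_.+1%:R == t : nat); apply/eqP.
by rewrite eqn_leq leq_divRL // le_j andbT -ltnS ltn_divLR.
Qed.

Lemma sum_index (J : eqType) (s : seq J) (g : nat -> nat) : uniq s ->
  (\sum_(j <- s) g (index j s) = \sum_(x < size s) g x)%N.
Proof.
case: s => [|j0 s] us; first by rewrite big_nil big_ord0.
rewrite (big_nth j0) big_mkord; apply: eq_bigr => i _.
by rewrite index_uniq.
Qed.

Section Normal.

Variable (F : fieldType) (m : nat).
Implicit Type v : 'cV[F]_m.

(** All nonzero multiples of v have the same support, so [pick] selects the same coordinate for them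
    and [normal] is a canonical representative of a projective point. The default 1 keeps [lead]
    invertible at v = 0. *)
Definition lead v : F := if [pick i | v i 0 != 0] is Some i then v i 0 else 1.
Definition normal v := (lead v)^-1 *: v.

Lemma lead_neq0 v : lead v != 0.
Proof. by rewrite /lead; case: pickP => // _; apply: oner_neq0. Qed.

Lemma lead_normal v : lead v *: normal v = v.
Proof. by rewrite scalerA mulfV ?lead_neq0 ?scale1r. Qed.

Lemma normalZ l v : l != 0 -> normal (l *: v) = normal v.
Proof.
move=> nz_l; have [->|/cV0Pn[i0 vi0]] := eqVneq v 0; first by rewrite scaler0.
rewrite /normal /lead (@eq_pick _ _ (fun i => v i 0 != 0)) => [|i]; last first.
  by rewrite mxE mulf_eq0 negb_or nz_l.
case: pickP => [i vi|/(_ i0)]; last by rewrite vi0.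
by rewrite mxE scalerA invfM mulrC mulrA mulfV ?mul1r.
Qed.

Lemma normal_eq0 v : (normal v == 0) = (v == 0).
Proof. by rewrite scaler_eq0 invr_eq0 (negPf (lead_neq0 v)). Qed.

End Normal.

Lemma in_line_normal m (v w : 'cV[K]_m) : v != 0 -> w != 0 ->
  in_line v w = (normal v == normal w).
Proof.
move=> nz_v nz_w; apply/existsP/eqP => [[l /eqP vE]|eq_n].
  rewrite vE normalZ //; apply: contraNneq nz_v => l0.
  by rewrite vE l0 scale0r.
exists (lead v / lead w); apply/eqP.
by rewrite -{1}(lead_normal v) eq_n scalerA.
Qed.

(* Within each projective point the values of z, normalised, are spread over
   K in consecutive blocks of size s, only the block of 0 being shorter by c.
   Listing xi and eta first puts them into the same block. *)
Lemma balanced_word (J : finType) m (v : J -> 'cV[K]_m) U c s (xi eta : J) :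
  (c <= s)%N -> (1 < s)%N -> (U + c = p * s)%N ->
  (forall w, w != 0 -> n_line v w = U) ->
  exists z : J -> K, (v xi = v eta -> z xi = z eta) /\
    forall a, (U * \sum_j ((v j != 0%R) && (z j == dot a (v j)))
       + c * \sum_j ((v j != 0%R) && (dot a (v j) == 0%R)) = s * n_active v)%N.
Proof.
move=> le_cs s_gt1 Uc nU.
pose L := if xi == eta then enum J else
  xi :: eta :: [seq j <- enum J | (j != xi) && (j != eta)].
have LP : perm_eq L (enum J).
  apply: uniq_perm; rewrite ?enum_uniq // /L; case: eqVneq => [_|ne].
  - exact: enum_uniq.
  - by rewrite /= !inE !mem_filter !eqxx (negPf ne) /= andbF filter_uniq
      ?enum_uniq.
  - by [].
  - move=> j; rewrite !inE mem_filter !mem_enum andbT.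
    by case: (j == xi) => //=; case: (j == eta).
pose cls j := [seq i <- L | (v i != 0) && (normal (v i) == normal (v j))].
have uniq_cls j : uniq (cls j) by rewrite filter_uniq // (perm_uniq LP)
  enum_uniq.
have sum_cls j (g : J -> nat) : (\sum_(i <- cls j) g i
    = \sum_(i | (v i != 0%R) && (normal (v i) == normal (v j))) g i)%N.
  by rewrite big_filter (perm_big _ LP) big_enum_cond; apply: eq_bigl => i.
have size_cls j : v j != 0 -> size (cls j) = U.
  move=> nz_j; rewrite -sum1_size sum_cls -(nU (v j) nz_j) big_mkcond /=.
  apply: eq_bigr => i _; case: eqP => //= /eqP nz_i.
  by rewrite in_line_normal //; case: ifP.
have eq_cls i j : normal (v i) = normal (v j) -> cls i = cls j.
  by move=> e; rewrite /cls e.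
pose phi j : K := (index j (cls j) %/ s).+1%:R.
have phi_eq : v xi = v eta -> phi xi = phi eta.
  move=> e_v; rewrite /phi.
  have [->|ne] := eqVneq xi eta; first by [].
  have [v0|nz] := eqVneq (v xi) 0.
    have cls0 j : v j = 0 -> cls j = [::].
      move=> vj0; apply/eqP; rewrite -[_ == _]negbK -has_filter.
      apply/negP => /hasP[i _ /andP[nz_i]]; rewrite vj0.
      by rewrite [X in _ == X]scaler0 normal_eq0 (negPf nz_i).
    by rewrite (cls0 xi v0) (cls0 eta) // -e_v.
  rewrite (eq_cls eta xi); last by rewrite e_v.
  have [l ->] : exists l, cls xi = [:: xi, eta & l].
    by rewrite /cls /L (negPf ne) /= -e_v eqxx nz; eexists.
  (* The positions 0 and 1 of xi and eta in their class share the first block because 1 < s. *)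
  by rewrite /= eqxx (negPf ne) eqxx !divn_small // ltnW.
exists (fun j => lead (v j) * phi j); split=> [e_v | a].
  by rewrite (phi_eq e_v) e_v.
have phiE j : (lead (v j) * phi j == dot a (v j)) = (phi j == dot a (normal (v
  j))).
  by rewrite -{2}(lead_normal (v j)) dotZr (inj_eq (mulfI (lead_neq0 _))).
have blocks i : v i != 0 ->
    (\sum_(j | (v j != 0%R) && (normal (v j) == normal (v i)))
       (lead (v j) * phi j == dot a (v j))%R + c * (dot a (v i) == 0%R) = s)%N.
  move=> nz_i; pose T := dot a (normal (v i)).
  have -> : (dot a (v i) == 0) = (T == 0).
    rewrite -{1}(lead_normal (v i)) dotZr mulf_eq0.
    by rewrite (negPf (lead_neq0 _)).
  rewrite -[RHS](sum_block_residue T le_cs Uc); congr (_ + _)%N.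
  rewrite -(size_cls i nz_i) -(sum_index (fun x => (x %/ s).+1%:R == T : nat)
    (uniq_cls i)).
  rewrite sum_cls; apply: eq_bigr => j /andP[nz_j /eqP e].
  by rewrite phiE /phi e (eq_cls j i).
(* Summing [blocks] over all active i counts each class once for each of its U members; this is the
   origin of the factor U. *)
have -> : (s * n_active v = \sum_(i | v i != 0%R)
    (\sum_(j | (v j != 0%R) && (normal (v j) == normal (v i)))
       (lead (v j) * phi j == dot a (v j))%R + c * (dot a (v i) == 0%R)))%N.
  rewrite (eq_bigr (fun=> s)) => [|i nz_i]; last exact: blocks.
  rewrite [LHS]big_distrr [RHS]big_mkcond /=; apply: eq_bigr => i _.
  by case: ifP; rewrite ?muln1 ?muln0.
rewrite big_split /=; congr (_ + _)%N; last first.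
  rewrite big_distrr [RHS]big_mkcond /=; apply: eq_bigr => i _.
  by case: ifP => _; rewrite ?muln0.
rewrite (exchange_big_dep (fun j => v j != 0)) /=; last by move=> i j _ /andP[].
rewrite [X in (U * X)%N](eq_bigr (fun j =>
  if v j != 0%R then (lead (v j) * phi j == dot a (v j))%R : nat else 0%N)).
  rewrite -big_mkcond big_distrr; apply: eq_bigr => j nz_j /=.
  rewrite sum_nat_const; congr (_ * _)%N.
  rewrite -[LHS](size_cls j nz_j) -sum1_size sum_cls -sum1_card;
    apply: eq_bigl => i.
  by rewrite unfold_in nz_j [normal (v j) == _]eq_sym.
by move=> j _; case: ifP.
Qed.

End BalancedWord.

(** * The order of an ordered basis and its minima *)

Section LexOrder.

Variables (p : nat) (p_prime : prime p).
Local Notation K := 'F_p.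
Local Notation V := (fsseq p).
Implicit Types (c x y z : V).

(** Comparing sequences at the largest differing index is comparing base p numbers; this transports
    the order to [nat], where minima exist. *)
Definition radix c : nat := (\sum_(i < size c) (c`_i)%R * p ^ i)%N.

Lemma Fp_ltn (t : K) : (t < p)%N.
Proof. by rewrite -[X in (_ < X)%N](Fp_cast p_prime). Qed.

Lemma radix_bound B c : (size c <= B)%N ->
  radix c = (\sum_(i < B) (c`_i)%R * p ^ i)%N.
Proof.
move=> le_B; rewrite /radix -!(big_mkord xpredT (fun i => (c`_i)%R * p ^ i)%N).
rewrite [RHS](big_cat_nat (leq0n _) le_B) /= [X in _ = (_ + X)%N]big_nat_cond
  [X in _ = (_ + X)%N]big1 ?addn0 // => i.
by case/andP=> /andP[le_i _] _; rewrite nth_default.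
Qed.

Lemma digit_sum_lt N c : (\sum_(i < N) (c`_i)%R * p ^ i < p ^ N)%N.
Proof.
elim: N => [|N IHN]; first by rewrite big_ord0.
rewrite big_ord_recr /= expnS.
apply: leq_trans (_ : ((c`_N)%R).+1 * p ^ N <= _)%N;
  last by rewrite leq_mul2r Fp_ltn orbT.
by rewrite mulSn -addSn leq_add2r.
Qed.

Lemma radix_split N c B : (size c <= N.+1 + B)%N ->
  radix c = (\sum_(i < N) (c`_i)%R * p ^ i + (c`_N)%R * p ^ N
    + \sum_(i < B) (c`_(N.+1 + i))%R * p ^ (N.+1 + i))%N.
Proof. by move/radix_bound->; rewrite big_split_ord big_ord_recr. Qed.

Lemma ltn_radix N c c' : (forall i, (N < i)%N -> c`_i = c'`_i) ->
  ((c`_N)%R < (c'`_N)%R)%N -> (radix c < radix c')%N.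
Proof.
move=> eq_top lt_N; pose B := maxn (size c) (size c').
have le_B : (B <= N.+1 + B)%N by rewrite leq_addl.
rewrite (@radix_split N c B); last exact: leq_trans (leq_maxl _ _) le_B.
rewrite (@radix_split N c' B); last exact: leq_trans (leq_maxr _ _) le_B.
rewrite (eq_bigr (fun i : 'I_B => (c'`_(N.+1 + i))%R * p ^ (N.+1 + i))%N);
  last first.
  by move=> i _; rewrite eq_top // ltnS leq_addr.
rewrite ltn_add2r.
apply: (@leq_trans (((c`_N)%R).+1 * p ^ N)).
  by rewrite mulSn ltn_add2r digit_sum_lt.
by rewrite (leq_trans _ (leq_addl _ _)) // leq_mul2r lt_N orbT.
Qed.

Lemma radix_lt_expn N c : (forall i, (N <= i)%N -> c`_i = 0) -> (radix c < p ^
  N)%N.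
Proof.
move=> c0; rewrite (@radix_bound N) ?digit_sum_lt //.
by apply/leq_sizeP.
Qed.

Lemma radix_ge_expn N c : c`_N != 0 -> (p ^ N <= radix c)%N.
Proof.
move=> nz; have lt_N : (N < size c)%N.
  by rewrite ltnNge; apply: contra nz => le; rewrite nth_default.
rewrite /radix (bigD1 (Ordinal lt_N)) //=; apply: leq_trans (leq_addr _ _).
by rewrite leq_pmull // lt0n; apply: contra nz => /eqP e; apply/eqP/val_inj.
Qed.

Lemma top_diff c c' : c != c' -> exists N, c`_N != c'`_N /\
  forall i, (N < i)%N -> c`_i = c'`_i.
Proof.
rewrite -subr_eq0 => nz; exists (size (c - c')).-1; split.
  by rewrite -subr_eq0 -coefB -lead_coefE lead_coef_eq0.
move=> i lt_i; apply/eqP; rewrite -subr_eq0 -coefB nth_default //.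
exact: leq_trans (leqSpred _) lt_i.
Qed.

Section Coordinates.

Variables (F : nat -> V) (beta : K) (xi eta : nat).
Hypothesis ne_xi_eta : xi != eta.
Hypothesis lincombF : forall c, lincomb F c = c + (beta * c`_xi) *: 'X^eta.

(** The inverse of [lincomb F]: as xi differs from eta, the correction does not alter the entry at
    xi from which it is computed. *)
Definition lex_coord x : V := x - (beta * x`_xi) *: 'X^eta.

Lemma lincombK c : lex_coord (lincomb F c) = c.
Proof.
rewrite /lex_coord lincombF coefD coefZ coefXn (negPf ne_xi_eta) mulr0 addr0.
by rewrite addrK.
Qed.

Lemma lex_coordK x : lincomb F (lex_coord x) = x.
Proof.
rewrite /lex_coord lincombF coefB coefZ coefXn (negPf ne_xi_eta) mulr0 subr0.
by rewrite subrK.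
Qed.

Definition lex_rank x := radix (lex_coord x).

Lemma lex_ltP x y : lex_lt F x y <-> (lex_rank x < lex_rank y)%N.
Proof.
split=> [[c [c' [-> -> [N [lt_N eqN]]]]] | lt_xy].
  by rewrite /lex_rank !lincombK; apply: ltn_radix lt_N.
exists (lex_coord x), (lex_coord y); rewrite !lex_coordK; split=> //.
have [|N [neN eqN]] := @top_diff (lex_coord x) (lex_coord y).
  by apply: contraTneq lt_xy; rewrite /lex_rank => ->; rewrite ltnn.
exists N; split=> //; case: ltngtP => // [gt_N | /val_inj eN].
  have := ltn_radix (fun i lt_i => esym (eqN i lt_i)) gt_N.
  by rewrite ltnNge ltnW.
by rewrite eN eqxx in neN.
Qed.

Lemma lex_rank_inj : injective lex_rank.
Proof.
move=> x y e; rewrite -[x]lex_coordK -[y]lex_coordK; congr (lincomb F _).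
apply/eqP; apply: contraTT isT => /top_diff[N [neN eqN]].
have [lt|lt|/val_inj eN] := ltngtP ((lex_coord x)`_N)%R ((lex_coord y)`_N)%R.
- by have := ltn_radix eqN lt; rewrite -/(lex_rank x) e ltnn.
- have := ltn_radix (fun i lt_i => esym (eqN i lt_i)) lt.
  by rewrite -/(lex_rank y) -e ltnn.
- by rewrite eN eqxx in neN.
Qed.

(** A word of least rank exists since ranks are natural numbers, and injectivity of the rank makes
    it a strict minimum, so [xget] does not fall back on its default. *)
Lemma xget_lex_min (P : V -> Prop) : (exists z, P z) ->
  let z := classical_sets.xget 0 (is_lex_min F P) in
  P z /\ forall y, P y -> (lex_rank z <= lex_rank y)%N.
Proof.
case=> z0 Pz0.
have [n [z Pz zn] n_min] : exists2 n, (exists2 z, P z & lex_rank z = n)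
    & forall y, P y -> (n <= lex_rank y)%N.
  have exn : exists n, boolp.asbool (exists2 z, P z & lex_rank z = n).
    by exists (lex_rank z0); apply/boolp.asboolP; exists z0.
  have [n /boolp.asboolP hn n_min] := ex_minnP exn; exists n => // y Py.
  by apply: n_min; apply/boolp.asboolP; exists y.
have z_min : is_lex_min F P z.
  split=> // y Py ne_yz; apply/lex_ltP;
    rewrite ltn_neqAle zn n_min // andbT -zn.
  by apply/eqP => /lex_rank_inj/esym.
have [Px x_min] := classical_sets.xgetPex 0 (ex_intro _ z z_min).
split=> // y Py; set x := classical_sets.xget _ _ in Px x_min *.
have [-> //|/eqP ne] := eqVneq y x; by apply/ltnW/lex_ltP/x_min.
Qed.

End Coordinates.

(** Both kinds of basis are treated at once: beta = 0 gives the standard basis, with arbitrary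
    distinct indices, and beta = 1 the twisted ones. *)
Lemma basis_familyE F : basis_family F -> exists (beta : K) (xi eta : nat),
  [/\ xi != eta, beta = 0 \/ beta = 1 &
    forall c, lincomb F c = c + (beta * c`_xi) *: 'X^eta].
Proof.
have lin_std c : \sum_(i < size c) c`_i *: 'X^i = c.
  by rewrite -[RHS]coefK poly_def.
case=> [->|[xi [eta [ne ->]]]].
  exists 0, 0%N, 1%N; split=> //; first by left.
  by move=> c; rewrite mul0r scale0r addr0 /lincomb lin_std.
exists 1, xi, eta; split=> //; [exact/eqP | by right |].
move=> c; rewrite mul1r /lincomb /twisted_basis.
have [lt_xi|le_xi] := ltnP xi (size c); last first.
  rewrite (nth_default _ le_xi) scale0r addr0 -[RHS]lin_std.
  apply: eq_bigr => i _; case: eqP => // e.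
  by have := ltn_ord i; rewrite e ltnNge le_xi.
rewrite (bigD1 (Ordinal lt_xi)) //= eqxx scalerDr.
rewrite -[X in _ = X + _]lin_std [in RHS](bigD1 (Ordinal lt_xi)) //= addrAC.
congr (_ + _ + _); apply: eq_bigr => i ne_i; case: eqP => // e.
by case/eqP: ne_i; apply: val_inj.
Qed.

End LexOrder.

(** * The words as linear combinations of generators *)

Section Words.

Variables (p : nat) (p_prime : prime p).
Local Notation K := 'F_p.
Local Notation V := (fsseq p).

Lemma hamming_bound B (x y : V) : (size x <= B)%N -> (size y <= B)%N ->
  hamming x y = (\sum_(i < B) (x`_i != y`_i)%R)%N.
Proof.
move=> xB yB; rewrite /hamming.
rewrite -!(big_mkord xpredT (fun i => (x`_i != y`_i)%R : nat)).
have le_B : (maxn (size x) (size y) <= B)%N by rewrite geq_max xB.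
rewrite [RHS](big_cat_nat (leq0n _) le_B) /=.
rewrite [X in _ = (_ + X)%N]big_nat_cond [X in _ = (_ + X)%N]big1 ?addn0 // =>
  i.
by rewrite andbT geq_max => /andP[/andP[xi yi] _]; rewrite !nth_default ?eqxx.
Qed.

Lemma hammingZ l (x y : V) : l != 0 -> hamming (l *: x) (l *: y) = hamming x y.
Proof.
move=> nz_l; rewrite /hamming !size_scale //.
by apply: eq_bigr => i _; rewrite !coefZ (inj_eq (mulfI nz_l)).
Qed.

Section Combinations.

Variables (g : nat -> V) (m : nat).

Definition comb (a : 'rV[K]_m) : V := \sum_(i < m) a 0 i *: g i.
Definition column (j : nat) : 'cV[K]_m := \col_(i < m) (g i)`_j.

Lemma coef_comb a j : (comb a)`_j = dot a (column j).
Proof.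
by rewrite coef_sum dotE; apply: eq_bigr => i _; rewrite coefZ mxE.
Qed.

Lemma combZ l a : comb (l *: a) = l *: comb a.
Proof. by rewrite scaler_sumr; apply: eq_bigr => i _; rewrite mxE scalerA. Qed.

Lemma size_comb B a : (forall i, (i < m)%N -> (size (g i) <= B)%N) ->
  (size (comb a) <= B)%N.
Proof.
move=> gB; apply: leq_trans (size_sum _ _ _) _; apply/bigmax_leqP => i _.
exact: leq_trans (size_scale_leq _ _) (gB _ (ltn_ord i)).
Qed.

Lemma hamming_comb B (z : V) a : (size z <= B)%N ->
  (forall i, (i < m)%N -> (size (g i) <= B)%N) ->
  hamming z (comb a)
    = word_dist (fun j : 'I_B => column j) (fun j => z`_j) a.
Proof.
move=> zB gB; rewrite (hamming_bound zB) ?size_comb //.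
by apply: eq_bigr => j _; rewrite coef_comb.
Qed.

Lemma column_bound B j : (forall i, (i < m)%N -> (size (g i) <= B)%N) ->
  (B <= j)%N -> column j = 0.
Proof.
move=> gB le_j; apply/colP => i; rewrite !mxE nth_default //.
exact: leq_trans (gB _ (ltn_ord i)) le_j.
Qed.

End Combinations.

Lemma coef_radix (c : V) i : digit p (radix c) i = c`_i.
Proof.
have p_gt0 := prime_gt0 p_prime; have p_gt1 := prime_gt1 p_prime.
rewrite /digit (@radix_split p i c (size c)) ?leq_addl //.
have -> : (\sum_(j < size c) (c`_(i.+1 + j))%R * p ^ (i.+1 + j) =
    (\sum_(j < size c) (c`_(i.+1 + j))%R * p ^ j) * p * p ^ i)%N.
  rewrite -mulnA -expnS big_distrl; apply: eq_bigr => j _ /=.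
  by rewrite expnD mulnCA mulnC mulnAC.
rewrite -addnA -mulnDl divnDMl ?expn_gt0 ?p_gt0 // divn_small ?digit_sum_lt //.
by rewrite add0n addnC modnMDl Fp_nat_mod // natr_Zp.
Qed.

Variables (F : nat -> V) (d : nat).
Local Notation w := (wminus F d).
Local Notation gen := (fun i => w (p ^ i)).

Lemma digit_default b m i : (b < p ^ m)%N -> (m <= i)%N -> digit p b i = 0.
Proof.
move=> lt_b le_mi; rewrite /digit divn_small ?mod0n //.
by apply: leq_trans lt_b _; rewrite leq_pexp2l ?prime_gt0.
Qed.

Lemma digit_expn j i : digit p (p ^ j) i = (i == j)%:R.
Proof.
have p_gt1 := prime_gt1 p_prime; rewrite /digit.
case: ltngtP => [lt_ij|lt_ji|->].
- by rewrite -(expnB (ltnW p_gt1) (ltnW lt_ij)) -(subnSK lt_ij) expnS modnMr.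
- by rewrite divn_small ?mod0n // ltn_exp2l.
- by rewrite divnn expn_gt0 (ltnW p_gt1) modn_small.
Qed.

(** A power of p has a single digit 1, so the digit formula holds for it as well; digits from
    position m on are 0, so the number of summands can be changed to m. *)
Lemma wminus_comb m b : (b < p ^ m)%N ->
  w b = comb gen (\row_(i < m) digit p b i).
Proof.
move=> lt_b; have p_gt1 := prime_gt1 p_prime.
rewrite /comb; under eq_bigr => i _ do rewrite mxE.
have [/existsP[[j lt_jb] /= /eqP bE]|npow] := boolP (is_power p b).
  rewrite {lt_jb}bE in lt_b *;
    have lt_jm : (j < m)%N by rewrite ltn_exp2l in lt_b.
  rewrite (bigD1 (Ordinal lt_jm)) //= big1 => [|i ne].
    by rewrite addr0 digit_expn eqxx scale1r.
  rewrite digit_expn (_ : (i == j :> nat) = false) ?scale0r //.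
  by apply: contraNF ne => /eqP e; apply/eqP/val_inj.
rewrite wminus_sum //.
have ext n n' : (n <= n')%N -> (b < p ^ n)%N ->
    \sum_(i < n) digit p b i *: gen i = \sum_(i < n') digit p b i *: gen i.
  move=> le_n lt_bn; rewrite -!(big_mkord xpredT (fun i => digit p b i *: gen
    i)).
  rewrite [RHS](big_cat_nat (leq0n _) le_n) /=.
  rewrite [X in _ = _ + X]big_nat_cond [X in _ = _ + X]big1 ?addr0 // => i.
  by rewrite andbT => /andP[le_i _]; rewrite (digit_default lt_bn) ?scale0r.
rewrite (ext _ _ (leq_maxl b m) (ltn_expl b p_gt1)).
by rewrite (ext _ _ (leq_maxr b m) lt_b).
Qed.

Lemma comb_wminus m (a : 'rV[K]_m) :
  exists2 b, (b < p ^ m)%N & w b = comb gen a.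
Proof.
(* The number whose base p digits are the entries of a. *)
exists (radix (rVpoly a)).
  apply: radix_lt_expn => // i le_i; rewrite nth_default //.
  exact: leq_trans (size_poly _ _) le_i.
rewrite (@wminus_comb m).
  by apply: eq_bigr => i _; rewrite mxE coef_radix coef_rVpoly_ord.
apply: radix_lt_expn => // i le_i; rewrite nth_default //.
exact: leq_trans (size_poly _ _) le_i.
Qed.

Lemma is_power_expn m : is_power p (p ^ m).
Proof.
by apply/existsP; exists (Ordinal (ltn_expl m (prime_gt1 p_prime))) => /=.
Qed.

Definition far m (z : V) := forall a : 'rV[K]_m, (d <= hamming z (comb gen
  a))%N.

(** The words with index below p^m are exactly the combinations of the first m generators, so the
    recursive choice minimises the rank among the words far from their span. *)
Lemma gen_lex_min (beta : K) (xi eta : nat) m : xi != eta ->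
  (forall c, lincomb F c = c + (beta * c`_xi) *: 'X^eta) ->
  (exists z, far m z) ->
  far m (gen m) /\
  forall y, far m y -> (lex_rank beta xi eta (gen m) <= lex_rank beta xi eta
    y)%N.
Proof.
move=> ne FE [z0 far_z0]; rewrite /= wminus_power ?is_power_expn //.
have farE z : far m z <-> forall b, (b < p ^ m)%N -> (d <= hamming z (w b))%N.
  split=> [far_z b lt_b | far_z a]; first by rewrite (wminus_comb lt_b).
  by have [b lt_b <-] := comb_wminus a; apply: far_z.
have ex_far : exists z, forall b, (b < p ^ m)%N -> (d <= hamming z (w b))%N.
  by exists z0; apply/farE.
have [far_z z_min] := xget_lex_min p_prime ne FE ex_far.
by split=> [|y /farE]; [apply/farE | apply: z_min].
Qed.

End Words.

(** * Greedy choice of a word *)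

Lemma seq_max (s : seq nat) : s != [::] ->
  exists2 M, M \in s & forall j, j \in s -> (j <= M)%N.
Proof.
elim: s => // x [|y s] IHs _; first by exists x; rewrite ?mem_head // => j;
  rewrite inE => /eqP->.
have [//|M Ms M_max] := IHs; exists (maxn x M).
  by case: (leqP x M) => _; rewrite inE ?eqxx // Ms orbT.
move=> j; rewrite inE => /predU1P[->|/M_max le_j]; first exact: leq_maxl.
exact: leq_trans le_j (leq_maxr _ _).
Qed.

Section Greedy.

Variables (p : nat) (p_prime : prime p).
Local Notation K := 'F_p.
Local Notation V := (fsseq p).

Definition indic (s : seq nat) : V := \sum_(j <- s) 'X^j.

Lemma coef_indic s i : uniq s -> (indic s)`_i = (i \in s)%:R.
Proof.
move=> us; rewrite coef_sum; have [i_s|i_s] := boolP (i \in s).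
  rewrite (bigD1_seq i) //= coefXn eqxx big1_seq ?addr0 // => j /andP[ne _].
  by rewrite coefXn eq_sym (negPf ne).
rewrite big1_seq // => j /andP[_ j_s]; rewrite coefXn.
by case: eqP => // e; rewrite e j_s in i_s.
Qed.

(** In the application [A] is the set of active coordinates of the code so far, [Z] the set of words
    at distance at least d from it, and [e] the least number of new coordinates. The last clause of
    [Z_ext] says that the F-coordinate at eta can stay 0 when it is 0 in y. *)
Variables (beta : K) (xi eta : nat) (A : pred nat) (Z : V -> Prop) (e : nat).

Hypotheses (beta01 : beta = 0 \/ beta = 1) (ne_xi_eta : xi != eta).
Hypothesis e_ge3 : (3 <= e)%N.

Definition extra (x : V) : seq nat :=
  [seq j <- iota 0 (size x) | ~~ A j && (x`_j != 0)].

Lemma mem_extra (x : V) j : (j \in extra x) = ~~ A j && (x`_j != 0).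
Proof.
rewrite mem_filter mem_iota add0n /=; case: ltnP => [|le];
  first by rewrite andbT.
by rewrite nth_default ?eqxx ?andbF.
Qed.

Lemma uniq_extra (x : V) : uniq (extra x).
Proof. by rewrite filter_uniq ?iota_uniq. Qed.

Lemma leq_size_extra s (x : V) : uniq s ->
  (forall j, j \in s -> ~~ A j && (x`_j != 0)) -> (size s <= size (extra x))%N.
Proof. by move=> us sx; apply: uniq_leq_size => // j /sx;
  rewrite mem_extra. Qed.

(* The twisted basis vector makes eta free as soon as xi is used, so that
   below an active coordinate other than eta one inactive coordinate may be
   left, but never two. *)
Definition no_two_holes (B : pred nat) := forall h1 h2 i,
  B i -> i != eta -> (h1 < h2)%N -> (h2 < i)%N -> h1 != eta -> h2 != eta ->
  B h1 || B h2.

Hypothesis A_holes : no_two_holes A.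
Hypothesis Z_extra : forall x, Z x -> (e <= size (extra x))%N.
Hypothesis Z_ext : forall y, (e <= size (extra y))%N -> exists x,
  [/\ Z x, forall j, ~~ A j -> x`_j = y`_j &
      y`_eta = beta * y`_xi -> x`_eta = beta * x`_xi].

Variable z : V.
Hypothesis Zz : Z z.
Hypothesis z_min : forall x, Z x ->
  (lex_rank beta xi eta z <= lex_rank beta xi eta x)%N.

Let crd := lex_coord beta xi eta.

Lemma coef_lex_coord (x : V) j : (crd x)`_j = x`_j - (beta * x`_xi) * (j ==
  eta)%:R.
Proof. by rewrite /crd /lex_coord coefB coefZ coefXn. Qed.

Lemma coef_lex_coord_neq (x : V) j : j != eta -> (crd x)`_j = x`_j.
Proof. by move=> /negPf ne; rewrite coef_lex_coord ne mulr0 subr0. Qed.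

Lemma coef_lex_coord_eta (x : V) : (crd x)`_eta = x`_eta - beta * x`_xi.
Proof. by rewrite coef_lex_coord eqxx mulr1. Qed.

(** By [Z_ext], y yields a word of [Z] whose F-coordinates vanish from N on. Its rank is below p^N,
    whereas that of z is at least p^N. *)
Lemma no_lower_word (y : V) N : (e <= size (extra y))%N ->
  (forall j, (N <= j)%N -> ~~ A j -> j != eta -> y`_j = 0) ->
  (forall i, A i -> i != eta -> (i < N)%N) ->
  ((N <= eta)%N -> y`_eta = beta * y`_xi) ->
  (crd z)`_N != 0 -> False.
Proof.
move=> /Z_ext[x [Zx xy x_eta]] y0 A_lt y_eta nz.
have := z_min Zx; rewrite leqNgt => /negP; apply.
apply: leq_trans (radix_ge_expn nz); apply: radix_lt_expn => // j le_Nj.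
have [je|ne] := eqVneq j eta.
  by rewrite je -/(crd _) coef_lex_coord_eta x_eta ?subrr // y_eta // -je.
rewrite -/(crd _) coef_lex_coord_neq //.
have notA : ~~ A j by apply/negP => /A_lt /(_ ne); rewrite ltnNge le_Nj.
by rewrite xy // y0.
Qed.

Lemma indic_extra s : uniq s -> (forall j, j \in s -> ~~ A j) ->
  (size s <= size (extra (indic s)))%N.
Proof.
move=> us sA; apply: leq_size_extra => // j js.
by rewrite sA //= coef_indic // js oner_eq0.
Qed.

(* W contains the extra coordinates of z, possibly with two more inactive ones.
   Dropping the largest one N, or eta, leaves enough of them for a smaller word.
   The exception is N = xi with eta > xi used for free: then either both are
   dropped, or the largest of the remaining ones is. *)
Lemma no_spare_extra W N : uniq W -> (forall j, j \in W -> ~~ A j) ->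
  {subset extra z <= W} -> (eta \in W -> eta \in extra z) ->
  N \in extra z -> N != eta -> (forall j, j \in W -> j != eta -> (j <= N)%N) ->
  (e < size W)%N -> (e.+1 < size W)%N \/ {subset W <= extra z} -> False.
Proof.
move=> uW WA EW eW NE N_eta W_le lt_eW W_alt.
have NW : N \in W by exact: EW.
have /andP[NA zN] : ~~ A N && (z`_N != 0) by rewrite -mem_extra.
have szW' : (e <= size (rem N W))%N by rewrite size_rem // -ltnS (ltn_predK
  lt_eW).
have mem_rem j : (j \in rem N W) = (j != N) && (j \in W) by rewrite
  mem_rem_uniq // inE.
have uW' : uniq (rem N W) by rewrite rem_uniq.
have W'A j : j \in rem N W -> ~~ A j by rewrite mem_rem => /andP[_ /WA].
(* As e >= 3, W has an element h besides N and eta; an active coordinate above N would have the two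
   holes h and N below it. *)
have A_lt i : A i -> i != eta -> (i < N)%N.
  move=> Ai ie; rewrite ltnNge; apply/negP;
    rewrite leq_eqVlt => /orP[/eqP eN|lt_Ni].
    by rewrite eN Ai in NA.
  have [h [hW hN he]] : exists h, [/\ h \in W, h != N & h != eta].
    have : has [pred h | (h != N) && (h != eta)] W.
      rewrite -[has _ _]negbK -all_predC; apply/negP => /allP allW.
      have : (size W <= size [:: N; eta])%N.
        apply: uniq_leq_size => // j /allW /=; rewrite negb_and !negbK !inE.
        by [].
      by move/(leq_trans (leq_trans e_ge3 (ltnW lt_eW))).
    by case/hasP => h hW /= /andP[hN he]; exists h.
  have lt_hN : (h < N)%N by rewrite ltn_neqAle hN W_le.
  by have := A_holes Ai ie lt_hN lt_Ni he N_eta;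
    rewrite (negPf (WA _ hW)) (negPf NA).
have crdN : (crd z)`_N != 0 by rewrite coef_lex_coord_neq.
have W'0 j : (N <= j)%N -> j != eta -> (indic (rem N W))`_j = 0.
  move=> le_Nj je; rewrite coef_indic // mem_rem; case: eqP => //= /eqP jN.
  case: (boolP (j \in W)) => // jW.
  by have := W_le j jW je; rewrite leqNgt ltn_neqAle eq_sym jN le_Nj.
have [lt_eta|ge_eta|eta_N] := ltngtP eta N; last by rewrite eta_N eqxx in N_eta.
  apply: (@no_lower_word (indic (rem N W)) N) => //.
  - exact: leq_trans szW' (indic_extra uW' W'A).
  - by move=> j le_Nj _; apply: W'0.
  - by rewrite leqNgt lt_eta.
have [eta_W|eta_W] := boolP (eta \in W); last first.
  (* The entry at eta is chosen so that the F-coordinate there is 0. *)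
  pose y := indic (rem N W) + (beta * (indic (rem N W))`_xi) *: 'X^eta.
  have y_neq j : j != eta -> y`_j = (indic (rem N W))`_j.
    by move=> /negPf je; rewrite coefD coefZ coefXn je mulr0 addr0.
  apply: (@no_lower_word y N) => //.
  - apply: leq_trans szW' (leq_size_extra uW' _) => j jW'.
    rewrite W'A // y_neq ?coef_indic ?jW' ?oner_eq0 //.
    by apply: contraNneq eta_W => <-; move: jW'; rewrite mem_rem => /andP[].
  - by move=> j le_Nj _ je; rewrite y_neq // W'0.
  - rewrite (y_neq xi) // coefD coefZ coefXn eqxx mulr1 coef_indic // mem_rem.
    by rewrite (negPf eta_W) andbF add0r.
have eta_E := eW eta_W.
have /andP[etaA z_eta] : ~~ A eta && (z`_eta != 0) by rewrite -mem_extra.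
have [crd_eta|crd_eta] := boolP ((crd z)`_eta == 0); last first.
  (* Since z has a nonzero F-coordinate at eta > N, dropping eta instead of N already lowers the
     rank. *)
  pose W1 := rem eta W.
  have uW1 : uniq W1 by rewrite rem_uniq.
  have W1A j : j \in W1 -> ~~ A j by rewrite mem_rem_uniq // inE => /andP[_
    /WA].
  pose y := indic W1 + (beta * (indic W1)`_xi) *: 'X^eta.
  have y_neq j : j != eta -> y`_j = (indic W1)`_j.
    by move=> /negPf je; rewrite coefD coefZ coefXn je mulr0 addr0.
  apply: (@no_lower_word y eta) => //.
  - apply: (@leq_trans (size W1));
      first by rewrite size_rem // -ltnS (ltn_predK lt_eW).
    apply: leq_size_extra => // j jW1;
      rewrite W1A // y_neq ?coef_indic ?jW1 ?oner_eq0 //.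
    by move: jW1; rewrite mem_rem_uniq // inE => /andP[].
  - move=> j le_j _ je;
      rewrite y_neq // coef_indic // mem_rem_uniq // inE je /=.
    case: (boolP (j \in W)) => // jW.
    by have := leq_trans ge_eta (leq_trans le_j (W_le j jW je)); rewrite ltnn.
  - by move=> i Ai ie; apply: ltn_trans ge_eta; apply: A_lt.
  - rewrite (y_neq xi) // coefD coefZ coefXn eqxx mulr1 coef_indic //.
    by rewrite mem_rem_uniq // inE eqxx add0r.
have z_eta_xi : z`_eta = beta * z`_xi.
  by apply/eqP; rewrite -subr_eq0 -coef_lex_coord_eta.
have [beta1 z_xi] : beta = 1 /\ z`_xi != 0.
  case: beta01 => [b0|b1]; first by rewrite z_eta_xi b0 mul0r eqxx in z_eta.
  by split=> //; rewrite z_eta_xi b1 mul1r in z_eta.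
have eta_W' : eta \in rem N W by rewrite mem_rem eq_sym N_eta.
have [xi_ok|] := boolP (A xi || (xi \in rem N W)).
  (* With the entry 1 at xi, the basis vector at xi supplies the entry 1 at eta for free. This costs
     nothing: xi is active or already counted. *)
  pose y := indic (rem N W) + (1 - (indic (rem N W))`_xi) *: 'X^xi.
  have y_neq j : j != xi -> y`_j = (indic (rem N W))`_j.
    by move=> /negPf je; rewrite coefD coefZ coefXn je mulr0 addr0.
  have y_xi : y`_xi = 1 by rewrite coefD coefZ coefXn eqxx mulr1 addrC subrK.
  apply: (@no_lower_word y N) => //.
  - apply: leq_trans szW' (leq_size_extra uW' _) => j jW'; rewrite W'A //=.
    have [->|jx] := eqVneq j xi; first by rewrite y_xi oner_eq0.
    by rewrite y_neq // coef_indic // jW' oner_eq0.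
  - move=> j le_Nj jA je; have [jx|jx] := eqVneq j xi;
      last by rewrite y_neq // W'0.
    move: xi_ok; rewrite -jx (negPf jA) /= => jW'.
    by have := W'0 j le_Nj je; rewrite coef_indic // jW' => /eqP;
      rewrite oner_eq0.
  - by rewrite y_xi y_neq ?coef_indic ?eta_W' ?beta1 ?mulr1 // eq_sym.
rewrite negb_or => /andP[xiA xiW'].
have xi_E : xi \in extra z by rewrite mem_extra xiA.
have xiN : xi = N.
  by apply/eqP; move: xiW'; rewrite mem_rem negb_and negbK (EW _ xi_E) /= orbF.
case: W_alt => [lt2|WE].
  pose W2 := rem eta (rem N W).
  have uW2 : uniq W2 by rewrite rem_uniq.
  have mem_W2 j : (j \in W2) = (j != eta) && (j \in rem N W) by rewrite
    [LHS]mem_rem_uniq // inE.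
  apply: (@no_lower_word (indic W2) N) => //.
  - apply: (@leq_trans (size W2)); first by rewrite !size_rem //;
      case: (size W) lt2 => [|[]].
    by apply: indic_extra => // j; rewrite mem_W2 => /andP[_ /W'A].
  - move=> j le_Nj _ je; have := W'0 j le_Nj je.
    by rewrite !coef_indic // mem_W2 je.
  - rewrite !coef_indic // !mem_W2 eqxx (negPf xiW') andbF mulr0.
    by [].
pose W2 := rem eta (rem N W).
have uW2 : uniq W2 by rewrite rem_uniq.
have mem_W2 j : (j \in W2) = (j != eta) && (j \in rem N W) by rewrite
  [LHS]mem_rem_uniq // inE.
have szW2 : (1 < size W2)%N.
  by rewrite !size_rem //; case: (size W) (leq_ltn_trans e_ge3 lt_eW) => [|[]].
have [|M MW2 M_max] := seq_max (s := W2); first by case: (W2) szW2.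
have [M' [M'W2 M'M]] : exists M', M' \in W2 /\ M' != M.
  have : has (fun h => h != M) W2.
    rewrite -[has _ _]negbK -all_predC; apply/negP => /allP allW.
    have : (size W2 <= size [:: M])%N.
      by apply: uniq_leq_size => // j /allW /=; rewrite negbK inE.
    by rewrite leqNgt szW2.
  by case/hasP => h; exists h.
have lt_M'M : (M' < M)%N by rewrite ltn_neqAle M'M M_max.
move: (MW2) (M'W2); rewrite !mem_W2 !mem_rem => /and3P[M_eta M_N MW]
  /and3P[M'_eta _ M'W].
have /andP[MA zM] : ~~ A M && (z`_M != 0) by rewrite -mem_extra WE.
(* Deleting only the entry at M from z keeps the F-coordinates above M, including the zero one at
   eta. No active coordinate other than eta lies above M, because M' and M would be two holes below
   it. *)
pose y := z - z`_M *: 'X^M.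
have y_neq j : j != M -> y`_j = z`_j.
  by move=> /negPf je; rewrite coefB coefZ coefXn je mulr0 subr0.
have yM : y`_M = 0 by rewrite coefB coefZ coefXn eqxx mulr1 subrr.
have szE : (e < size (extra z))%N := leq_trans lt_eW (uniq_leq_size uW WE).
have [|x [Zx xy x_eta]] := Z_ext (y := y).
  apply: (@leq_trans (size (rem M (extra z)))).
    rewrite size_rem; last by rewrite mem_extra MA.
    by rewrite -ltnS (ltn_predK szE).
  apply: leq_size_extra; first by rewrite rem_uniq ?uniq_extra.
  move=> j; rewrite mem_rem_uniq ?uniq_extra // inE => /andP[jM].
  by rewrite mem_extra y_neq.
have := z_min Zx; rewrite leqNgt => /negP; apply.
apply: (@ltn_radix p p_prime M) => [i lt_Mi|].
  have iM : i != M by rewrite neq_ltn lt_Mi orbT.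
  have [ie|ie] := eqVneq i eta.
    have eta_M : eta != M by rewrite eq_sym.
    have xi_M : xi != M by rewrite xiN eq_sym.
    by rewrite ie !coef_lex_coord_eta x_eta ?subrr ?z_eta_xi ?subrr // !y_neq.
  rewrite !coef_lex_coord_neq // xy ?y_neq //; apply/negP => Ai.
  have := A_holes Ai ie lt_M'M lt_Mi M'_eta M_eta.
  by rewrite (negPf MA) (negPf (WA _ M'W)).
rewrite !coef_lex_coord_neq // xy // yM lt0n; apply: contra zM => /eqP zM0.
exact/eqP/val_inj.
Qed.

(** Both claims follow from [no_spare_extra]: the first with W the extra coordinates of z, if there
    were more than e; the second after adding to them two holes h1 and h2 below an occupied i. *)
Theorem greedy_step :
  size (extra z) = e /\ no_two_holes (fun j => A j || (z`_j != 0)).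
Proof.
have le_e := Z_extra Zz.
have [|N NE N_max] := seq_max (s := [seq j <- extra z | j != eta]).
  apply/eqP => nil; have : (size (extra z) <= size [:: eta])%N.
    apply: uniq_leq_size (uniq_extra z) _ => j jE; rewrite inE.
    by apply/negPn/negP => je; have := in_nil j; rewrite -nil mem_filter je jE.
  by move/(leq_trans (leq_trans e_ge3 le_e)).
move: NE; rewrite mem_filter => /andP[N_eta NE].
have EA j : j \in extra z -> ~~ A j by rewrite mem_extra => /andP[].
have E_le j : j \in extra z -> j != eta -> (j <= N)%N.
  by move=> jE je; apply: N_max; rewrite mem_filter je.
have size_e : size (extra z) = e.
  apply/eqP; rewrite eqn_leq le_e andbT leqNgt; apply/negP => lt_e.
  by apply: (no_spare_extra (uniq_extra z) EA _ _ NE N_eta E_le lt_e) => //;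
    right.
split=> // h1 h2 i Bi ie lt12 lt2i h1e h2e.
apply/negPn/negP; rewrite !negb_or !negbK.
case/andP=> /andP[h1A /eqP zh1] /andP[h2A /eqP zh2].
case/orP: Bi => [Ai|zi].
  by have := A_holes Ai ie lt12 lt2i h1e h2e; rewrite (negPf h1A) (negPf h2A).
have h1E : h1 \notin extra z by rewrite mem_extra zh1 eqxx andbF.
have h2E : h2 \notin extra z by rewrite mem_extra zh2 eqxx andbF.
have [Ai|Ai] := boolP (A i).
  by have := A_holes Ai ie lt12 lt2i h1e h2e; rewrite (negPf h1A) (negPf h2A).
have le_iN : (i <= N)%N by rewrite E_le // mem_extra Ai.
apply: (@no_spare_extra [:: h1, h2 & extra z] N) => //.
- by rewrite /= inE negb_or (ltn_eqF lt12) h1E h2E uniq_extra.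
- by move=> j; rewrite !inE => /or3P[/eqP->|/eqP->|/EA].
- by move=> j jE; rewrite !inE jE !orbT.
- by rewrite !inE ![eta == _]eq_sym (negPf h1e) (negPf h2e).
- move=> j; rewrite !inE => /or3P[/eqP->|/eqP->|/E_le //] _.
    exact: leq_trans (ltnW (ltn_trans lt12 lt2i)) le_iN.
  exact: leq_trans (ltnW lt2i) le_iN.
- by rewrite /= size_e.
- by left; rewrite /= size_e.
Qed.

End Greedy.

(** * Adjoining one word to a constant-weight code *)

Section Step.

Variables (p : nat) (p_prime : prime p).
Local Notation K := 'F_p.
Local Notation V := (fsseq p).

Variables (F : nat -> V) (d : nat).
Local Notation gen := (fun i => wminus F d (p ^ i)).

Variables (beta : K) (xi eta : nat).
Hypotheses (beta01 : beta = 0 \/ beta = 1) (ne_xi_eta : xi != eta).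
Hypothesis lincombF : forall c, lincomb F c = c + (beta * c`_xi) *: 'X^eta.

(** Here n is the length of the code so far, U the multiplicity of each projective point among its
    columns, e the quotient U / p rounded up, and c the rounding defect. *)
Variables (m n U c e : nat).
Local Notation active := (fun j => column gen m j != 0).
Local Notation vB B := (fun j : 'I_B => column gen m j).
Local Notation zB B z := (fun j : 'I_B => (z : V)`_j).

Definition gens_bounded B := forall i, (i < m)%N -> (size (gen i) <= B)%N.

Hypothesis d_gt0 : (0 < d)%N.
Hypothesis length_n : forall B, gens_bounded B -> n_active (vB B) = n.
Hypothesis weights : forall a : 'rV[K]_m, a != 0 -> hamming 0 (comb gen a) = d.
Hypothesis holes : no_two_holes eta active.
Hypothesis nU : ((p - 1) * n + U = p * d)%N.
Hypothesis Um : (U * p ^ m = p * d)%N.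
Hypothesis Uc : (U + c = p * e)%N.
Hypotheses (lt_cp : (c < p)%N) (le_ce : (c <= e)%N) (e_ge3 : (3 <= e)%N).

Lemma ex_gens_bound N : exists2 B, gens_bounded B & (N <= B)%N.
Proof.
exists (maxn N (\max_(i < m) size (gen i))); last exact: leq_maxl.
move=> i lt_i; apply: leq_trans (leq_maxr _ _).
exact: (leq_bigmax (Ordinal lt_i)).
Qed.

Lemma size_extra B (z : V) : (size z <= B)%N ->
  size (extra active z) = n_extra (vB B) (zB B z).
Proof.
move=> le_zB; rewrite size_filter -sum1_count /n_extra.
rewrite -(big_mkord xpredT (fun j => (column gen m j == 0) && (z`_j != 0) :
  nat)).
rewrite [RHS](big_cat_nat (leq0n _) le_zB) /=.
rewrite [X in _ = (_ + X)%N]big_nat_cond [X in _ = (_ + X)%N]big1; last first.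
  by move=> j; rewrite andbT => /andP[le_j _];
    rewrite nth_default // eqxx andbF.
rewrite addn0 /index_iota subn0 big_mkcond; apply: eq_bigr => j _.
by rewrite negbK; case: ifP.
Qed.

Lemma far_word_dist B (z : V) : gens_bounded B -> (size z <= B)%N ->
  far F d m z -> forall a, (d <= word_dist (vB B) (zB B z) a)%N.
Proof. by move=> gB le_zB far_z a; rewrite -hamming_comb. Qed.

Lemma sum_dist B (z : V) : gens_bounded B ->
  (p * \sum_a word_dist (vB B) (zB B z) a
    = p ^ m * (p * n_extra (vB B) (zB B z) + (p - 1) * n))%N.
Proof.
move=> gB; have := sum_word_dist (vB B) (zB B z).
by rewrite card_Fp // length_n.
Qed.

(** The average distance from z to the code is at least d, which gives U <= p ext for the number ext
    of new coordinates; U = p e - c with c < p does the rounding. *)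
Lemma far_extra (z : V) : far F d m z -> (e <= size (extra active z))%N.
Proof.
move=> far_z; have [B gB le_zB] := ex_gens_bound (size z).
rewrite (size_extra le_zB).
have := sum_dist z gB; set ext := n_extra _ _ => sumE.
have : (\sum_(a : 'rV[K]_m) d <= \sum_a word_dist (vB B) (zB B z) a)%N.
  by apply: leq_sum => a _; apply: far_word_dist.
rewrite sum_nat_const card_mx card_Fp // mul1n => le_sum.
have : (p ^ m * (p * d) <= p ^ m * (p * ext + (p - 1) * n))%N.
  by rewrite -sumE mulnCA leq_mul2l le_sum orbT.
rewrite leq_pmul2l ?expn_gt0 ?prime_gt0 // -nU [X in (_ <= X)%N]addnC leq_add2l
  => le_U.
have : (p * e < p * ext.+1)%N by rewrite -Uc mulnS addnC -addSn; apply: leq_add.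
by rewrite ltn_pmul2l ?prime_gt0.
Qed.

(** Without rounding the average distance is exactly d, so no distance can exceed d. *)
Lemma far_exact (z : V) : c = 0%N -> far F d m z -> size (extra active z) = e ->
  forall a : 'rV[K]_m, hamming z (comb gen a) = d.
Proof.
move=> c0 far_z size_e a; have [B gB le_zB] := ex_gens_bound (size z).
have := sum_dist z gB; rewrite -size_extra // size_e.
have -> : (p * e + (p - 1) * n = p * d)%N by rewrite -Uc c0 addn0 addnC.
rewrite mulnCA => /eqP; rewrite eqn_pmul2l ?prime_gt0 // => /eqP sumE.
have := leqif_sum (fun a (_ : true) => leqif_eq (far_word_dist gB le_zB far_z
  a)).
rewrite sum_nat_const card_mx card_Fp // mul1n => -[_].
rewrite sumE eqxx => /esym/forallP/(_ a)/eqP e_a.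
by rewrite (hamming_comb _ le_zB gB) -e_a.
Qed.

Lemma class_size B w : gens_bounded B -> w != 0 -> n_line (vB B) w = U.
Proof.
move=> gB; apply: (@constant_weight_line _ _ _ _ d);
  rewrite ?card_Fp ?length_n //.
move=> a nz_a; transitivity (hamming 0 (comb gen a)); last exact: weights.
rewrite (hamming_comb _ _ gB) ?size_poly0 //.
by apply: eq_bigr => j _; rewrite coef0 eq_sym.
Qed.

Lemma U_gt0 : (0 < U)%N.
Proof.
rewrite lt0n; apply/eqP => U0; move: Um; rewrite U0 mul0n => /esym/eqP.
by rewrite muln_eq0 !eqn0Ngt d_gt0 prime_gt0.
Qed.

Lemma far_translate (x : V) (a0 : 'rV[K]_m) : far F d m x -> far F d m (x +
  comb gen a0).
Proof.
move=> far_x a; have [B gB xB] := ex_gens_bound (size x).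
have [B' gB' xB'] := ex_gens_bound (size (x + comb gen a0)).
apply: leq_trans (far_x (a - a0)) _.
have le1 := leq_maxl B B'; have le2 := leq_maxr B B'.
have gBB : gens_bounded (maxn B B') by move=> i /gB /leq_trans; apply.
rewrite !(@hamming_comb _ _ _ (maxn B B')) ?(leq_trans xB) ?(leq_trans xB') //.
rewrite leq_eqVlt; apply/orP; left; apply/eqP; apply: eq_bigr => j _.
by rewrite coefD coef_comb dotBl eq_sym subr_eq eq_sym.
Qed.

Lemma far_extend (y : V) : (e <= size (extra active y))%N -> exists x,
  [/\ far F d m x, forall j, ~~ active j -> x`_j = y`_j &
      y`_eta = beta * y`_xi -> x`_eta = beta * x`_xi].
Proof.
move=> le_ext.
have [B gB] := ex_gens_bound (maxn (size y) (maxn xi.+1 eta.+1)).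
rewrite !geq_max => /and3P[yB xiB etaB].
have [|z0 [z0_eq z0P]] := balanced_word p_prime (Ordinal xiB) (Ordinal etaB)
  le_ce _ Uc (fun w => class_size gB (w := w)).
  exact: leq_trans e_ge3.
pose x : V := \poly_(j < B) (if insub j is Some i then
  if column gen m j != 0 then z0 i else y`_j else 0).
have xE (j : 'I_B) : x`_j = if column gen m j != 0 then z0 j else y`_j.
  by rewrite coef_poly ltn_ord valK.
have x_off j : ~~ active j -> x`_j = y`_j.
  have [lt_j|le_j] := ltnP j B;
    first by rewrite (xE (Ordinal lt_j)) /= => /negPf->.
  by rewrite !nth_default // ?(leq_trans yB) // (leq_trans (size_poly _ _)).
have far_x : far F d m x.
  move=> a; rewrite (hamming_comb _ (size_poly _ _) gB).
  rewrite (size_extra yB) in le_ext.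
  (* [Ag] counts the agreements with the codeword of a on active coordinates and [Zr] the zeros of
     that codeword there. Constant weight bounds [Zr] from below, and the balance identity turns
     this into an upper bound for [Ag]. *)
  have := z0P a; set Ag := (\sum_j _)%N; set Zr := (\sum_j _)%N.
  rewrite length_n // => bal.
  have distE : (word_dist (vB B) (zB B x) a + Ag = n + n_extra (vB B) (zB B
    y))%N.
    rewrite -(length_n gB) -!big_split; apply: eq_bigr => j _ /=; rewrite xE.
    have [->|_] := eqVneq (column gen m j) 0; first by rewrite dot0r addn0.
    by case: (z0 j == _).
  have ZrE : (n <= Zr + d)%N.
    have [a0|nz_a] := eqVneq a 0.
      rewrite -(length_n gB) (_ : Zr = n_active (vB B)) ?leq_addr //.
      by apply: eq_bigr => j _; rewrite a0 dot0l eqxx andbT.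
    rewrite -[X in (_ + X)%N](weights nz_a) (hamming_comb _ _ gB) ?size_poly0
      //.
    rewrite -(length_n gB) -big_split; apply: leq_sum => j _ /=;
      rewrite coef0 [0 == _]eq_sym.
    by case: (column gen m j == 0) => //; case: (dot _ _ == 0).
  rewrite -(leq_add2r Ag) distE; apply: (@leq_trans (n + e));
    last by rewrite leq_add2l.
  rewrite -(leq_pmul2l U_gt0) -(leq_add2r (c * n)).
  have -> : (U * (d + Ag) + c * n = U * d + (U * Ag + c * n))%N by ring.
  apply: (@leq_trans (U * d + (U * Ag + c * (Zr + d)))).
    by rewrite !leq_add2l leq_mul2l ZrE orbT.
  rewrite (mulnDr c) [(U * Ag + _)%N]addnA bal.
  have -> : (U * d + (e * n + c * d) = e * n + (U + c) * d)%N by ring.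
  have -> : ((U + c) * d = e * ((p - 1) * n + U))%N by rewrite Uc nU; ring.
  have pn : ((p - 1) * n + n = p * n)%N by rewrite mulnBl mul1n subnK //
    leq_pmull ?prime_gt0.
  have -> : (e * n + e * ((p - 1) * n + U) = e * ((p - 1) * n + n) + e * U)%N
    by ring.
  rewrite pn [(e * (p * n))%N]mulnA [(e * p)%N]mulnC -Uc.
  have -> : ((U + c) * n + e * U = U * (n + e) + c * n)%N by ring.
  exact: leqnn.
have [bal|unbal] := eqVneq (column gen m eta) (beta *: column gen m xi).
  exists x; split=> // y_eta.
  have [col0|ncol0] := eqVneq (column gen m eta) 0.
    rewrite x_off ?col0 ?eqxx // y_eta; case: beta01 => b;
      first by rewrite b !mul0r.
    by rewrite x_off // negbK -col0 bal b scale1r.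
  have b1 : beta = 1.
    by case: beta01 => // b; rewrite bal b scale0r eqxx in ncol0.
  rewrite b1 scale1r in bal; rewrite b1 mul1r.
  rewrite (xE (Ordinal etaB)) (xE (Ordinal xiB)) /= ncol0 -bal ncol0.
  by apply/esym/z0_eq; rewrite /= bal.
have [|a0 a0E] := dot_surj (v := column gen m eta - beta *: column gen m xi) _
  (beta * x`_xi - x`_eta).
  by rewrite subr_eq0.
exists (x + comb gen a0); split=> [|j nact|_]; first exact: far_translate.
  by rewrite coefD coef_comb (eqP (negbNE nact)) dot0r addr0 x_off.
rewrite !coefD !coef_comb; apply/eqP; rewrite -subr_eq0; apply/eqP.
move: a0E; rewrite dotBr dotZr => /eqP; rewrite -subr_eq0 => /eqP a0E.
by rewrite -[RHS]a0E; ring.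
Qed.

Theorem gen_step :
  [/\ far F d m (gen m), size (extra active (gen m)) = e,
      no_two_holes eta (fun j => active j || ((gen m)`_j != 0)) &
      c = 0%N -> forall a : 'rV[K]_m, hamming (gen m) (comb gen a) = d].
Proof.
have ex_far : exists z, far F d m z.
  have [B gB _] := ex_gens_bound 0.
  (* A word supported on e coordinates beyond all generators. *)
  have [|x [far_x _ _]] := @far_extend (\poly_(j < B + e) (B <= j)%:R);
    last by exists x.
  apply: (@leq_trans (size (iota B e))); first by rewrite size_iota.
  apply: leq_size_extra; first exact: iota_uniq.
  move=> j; rewrite mem_iota => /andP[le_j lt_j].
  by rewrite (column_bound gB le_j) eqxx coef_poly lt_j le_j oner_eq0.
have [far_g min_g] := gen_lex_min p_prime ne_xi_eta lincombF ex_far.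
have [size_g holes_g] := greedy_step p_prime beta01 ne_xi_eta e_ge3 holes
  far_extra
  far_extend far_g min_g.
by split=> // c0; apply: far_exact.
Qed.

End Step.

(** * The first k words span a multiple of a simplex code *)

Section Simplex.

Variables (p : nat) (p_prime : prime p).
Local Notation K := 'F_p.
Local Notation V := (fsseq p).

Lemma hamming_sub (x y : V) : hamming x y = hamming 0 (x - y).
Proof.
pose B := maxn (size x) (size y).
have xyB : (size (x - y)%R <= B)%N.
  by apply: leq_trans (size_polyD _ _) _; rewrite size_polyN.
rewrite (@hamming_bound p B x) ?leq_maxl ?leq_maxr //.
rewrite (@hamming_bound p B 0) ?size_poly0 //; apply: eq_bigr => i _.
by rewrite coefB coef0 [in RHS]eq_sym subr_eq0.
Qed.

Variables (F : nat -> V) (d : nat).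
Local Notation gen := (fun i => wminus F d (p ^ i)).

Variables (beta : K) (xi eta : nat).
Hypotheses (beta01 : beta = 0 \/ beta = 1) (ne_xi_eta : xi != eta).
Hypothesis lincombF : forall c, lincomb F c = c + (beta * c`_xi) *: 'X^eta.
Hypothesis d_gt0 : (0 < d)%N.

Lemma column_succ m j :
  column gen (m + 1) j = col_mx (column gen m j) ((gen m)`_j)%:M.
Proof.
apply/colP => i; rewrite !mxE; case: splitP => i' /= ->; rewrite !mxE //.
by rewrite [i']ord1 addn0 eqxx mulr1n.
Qed.

Lemma column_succ_neq0 m j :
  (column gen (m + 1) j != 0) = (column gen m j != 0) || ((gen m)`_j != 0).
Proof.
rewrite column_succ col_mx_eq0 negb_and; congr (_ || ~~ _).
by apply/eqP/eqP => [/matrixP/(_ 0 0)|->]; rewrite ?raddf0 // !mxE eqxx mulr1n.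
Qed.

Lemma comb_succ m (a : 'rV[K]_(m + 1)) :
  comb gen a = comb gen (lsubmx a) + rsubmx a 0 0 *: gen m.
Proof.
rewrite /comb big_split_ord big_ord1 /=; congr (_ + _).
  by apply: eq_bigr => i _; rewrite mxE.
by rewrite mxE addn0.
Qed.

Lemma n_active_succ m e n :
  (forall B, gens_bounded F d m B -> n_active (fun j : 'I_B => column gen m j)
    = n) ->
  size (extra (fun j => column gen m j != 0) (gen m)) = e ->
  forall B, gens_bounded F d (m + 1) B ->
    n_active (fun j : 'I_B => column gen (m + 1) j) = (n + e)%N.
Proof.
move=> len size_e B gB.
rewrite -(len B) => [|i lt_i]; last by apply: gB; rewrite addn1 ltnS ltnW.
rewrite -size_e (@size_extra p F d m B); last by apply: gB; rewrite addn1.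
rewrite -big_split; apply: eq_bigr => j _; rewrite column_succ_neq0.
by case: (column gen m j == 0); case: ((gen m)`_j == 0).
Qed.

Lemma hamming_comb_succ m (a : 'rV[K]_(m + 1)) : rsubmx a 0 0 != 0 ->
  hamming 0 (comb gen a) = hamming (gen m) (comb gen (- (rsubmx a 0 0)^-1 *:
    lsubmx a)).
Proof.
move=> nz; rewrite comb_succ [RHS]hamming_sub -[RHS](hammingZ _ _ nz) scaler0.
congr (hamming 0 _); rewrite combZ scaleNr opprK scalerDr scalerA mulfV //
  scale1r.
by rewrite addrC.
Qed.

Lemma hamming_comb_pred m (a : 'rV[K]_(m + 1)) : rsubmx a 0 0 = 0 ->
  comb gen a = comb gen (lsubmx a).
Proof. by move=> a0; rewrite comb_succ a0 scale0r addr0. Qed.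

Lemma lsubmx_neq0 m (a : 'rV[K]_(m + 1)) : a != 0 -> rsubmx a 0 0 = 0 -> lsubmx
  a != 0.
Proof.
move=> nz a0; apply: contraNneq nz => l0;
  rewrite -[a]hsubmxK l0 [rsubmx a]mx11_scalar.
by rewrite a0 raddf0 row_mx0.
Qed.

Variables (k u : nat).
Hypothesis u_ge3 : (3 <= u)%N.
Hypothesis k_gt0 : (0 < k)%N.
Hypothesis d_def : d = (p ^ (k - 1) * u)%N.

(** Induction by [gen_step] with U = u p^(k-m) and c = 0: for m < k this U is divisible by p, so
    each word adds exactly U / p coordinates and the weight stays constant. *)
Lemma simplex_prefix m : (m <= k)%N -> exists n,
  [/\ forall B, gens_bounded F d m B -> n_active (fun j : 'I_B => column gen m
    j) = n,
      forall a : 'rV[K]_m, a != 0 -> hamming 0 (comb gen a) = d,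
      no_two_holes eta (fun j => column gen m j != 0) &
      ((p - 1) * n + u * p ^ (k - m) = p * d)%N].
Proof.
have p_gt0 := prime_gt0 p_prime.
have pd : (p * d = u * p ^ k)%N.
  by rewrite d_def mulnA -expnS subn1 prednK // mulnC.
elim: m => [_|m IHm lt_mk].
  exists 0%N; split.
  - by move=> B _; rewrite /n_active big1 // => j _; rewrite flatmx0 eqxx.
  - by move=> a; rewrite [a]thinmx0 eqxx.
  - by move=> h1 h2 i; rewrite flatmx0 eqxx.
  - by rewrite muln0 subn0.
have [n [len wt holes nU]] := IHm (ltnW lt_mk).
have kmE : (k - m = (k - m.+1).+1)%N by rewrite subnSK.
have Um : (u * p ^ (k - m) * p ^ m = p * d)%N by rewrite -mulnA -expnD subnK
  ?pd // ltnW.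
have Uc : (u * p ^ (k - m) + 0 = p * (u * p ^ (k - m.+1)))%N by rewrite addn0
  kmE expnS mulnCA.
have [||_ size_e holes' wt'] := gen_step p_prime beta01 ne_xi_eta lincombF
  d_gt0 len wt holes nU Um Uc p_gt0.
- by [].
- by apply: leq_trans u_ge3 _; rewrite leq_pmulr // expn_gt0 p_gt0.
rewrite -addn1; exists (n + u * p ^ (k - m.+1))%N; split.
- exact: n_active_succ.
- move=> a nz_a; have [a0|nz] := eqVneq (rsubmx a 0 0) 0.
    by rewrite hamming_comb_pred // wt // lsubmx_neq0.
  by rewrite hamming_comb_succ // wt'.
- move=> h1 h2 i; rewrite !column_succ_neq0; exact: holes'.
- rewrite addn1 -nU kmE expnS mulnDr -addnA; congr (_ + _)%N.
  by rewrite mulnBl mul1n subnK ?leq_pmull // mulnCA.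
Qed.

End Simplex.

(** * The last word and the missing hyperplanes *)

Section MissingHyperplanes.

Variables (p : nat) (p_prime : prime p).
Local Notation K := 'F_p.

Variables (k : nat) (J : finType) (v : J -> 'cV[K]_k) (z : J -> K) (d U c e :
  nat).
Hypotheses (k_gt0 : (0 < k)%N) (lt_cp : (c < p)%N).
Hypothesis line_U : forall w, w != 0 -> n_line v w = U.
Hypothesis extra_e : n_extra v z = e.
Hypothesis far_dist : forall a, (d <= word_dist v z a)%N.
Hypothesis nU : ((p - 1) * n_active v + U = p * d)%N.
Hypothesis Uc : (U + c = p * e)%N.

Let excess a := (word_dist v z a - d)%N.

Lemma excessK a : (excess a + d = word_dist v z a)%N.
Proof. exact: subnK. Qed.

Lemma expn_pred_k : (p ^ k = p * p ^ (k - 1))%N.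
Proof. by rewrite -expnS subn1 prednK. Qed.

(** This is [sum_word_dist_hyperplane] with all multiplicities equal to U, after removing d at each
    of the p^(k-1) points of the hyperplane. *)
Lemma sum_excess_hyperplane w t : w != 0 ->
  (\sum_(a | dot a w == t) excess a + p ^ (k - 1) * n_graph v z w t = p ^ (k -
    1) * e)%N.
Proof.
move=> nz_w; have p_gt0 := prime_gt0 p_prime.
have := sum_word_dist_hyperplane v z t nz_w.
rewrite card_Fp // extra_e line_U // expn_pred_k.
have := n_line_add v w; rewrite line_U // => nE.
have := card_dot t nz_w; rewrite card_Fp // expn_pred_k => /eqP.
rewrite eqn_pmul2l // => /eqP cardH.
have -> : (\sum_(a | dot a w == t) word_dist v z a
    = \sum_(a | dot a w == t) excess a + p ^ (k - 1) * d)%N.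
  under eq_bigr => a _ do rewrite -excessK.
  by rewrite big_split /= sum_nat_const -cardH.
set S := (\sum_(a | _) _)%N; set M := n_graph _ _ _ _; set H := (p ^ (k - 1))%N.
move: nU; rewrite -nE; set N' := n_off_line _ _ => nU' E.
have pU : ((p - 1) * U + U = p * U)%N by rewrite mulnBl mul1n subnK //
  leq_pmull.
have e1 : (p * p * (S + H * M) + p * p * H * d = p * p * (H * e) + p * p * H *
  d)%N.
  transitivity (p ^ 2 * (S + H * d) + p * H * (p * M))%N;
    first by rewrite -mulnn; ring.
  rewrite E.
  have -> : (p * p * H * d = p * H * ((p - 1) * (U + N') + U))%N by rewrite
    nU'; ring.
  by rewrite -pU; ring.
have pp_gt0 : (0 < p * p)%N by rewrite muln_gt0 p_gt0.
by apply/eqP; rewrite -(eqn_pmul2l pp_gt0); apply/eqP; apply: addIn e1.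
Qed.

Lemma sum_excess : (\sum_a excess a = p ^ (k - 1) * c)%N.
Proof.
have p_gt0 := prime_gt0 p_prime.
have := sum_word_dist v z; rewrite card_Fp // extra_e.
have -> : (p * e + (p - 1) * n_active v = p * d + c)%N by rewrite -Uc -nU; ring.
under eq_bigr => a _ do rewrite -excessK.
rewrite big_split /= sum_nat_const card_mx mul1n card_Fp // expn_pred_k.
set S := (\sum_a _)%N; set H := (p ^ (k - 1))%N => E.
apply/eqP; rewrite -(@eqn_pmul2l p) //; apply/eqP.
apply: (@addIn (p * (p * H * d))%N); rewrite -mulnDr E; ring.
Qed.

(* g a is the number of times the hyperplane {(w; t) | a.w = t} is removed. *)
Theorem missing_hyperplanes : exists g : 'rV[K]_k -> nat,
  (\sum_a g a = c)%N /\ forall w t, w != 0 ->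
    (\sum_(a | dot a w == t) g a + n_graph v z w t = e)%N.
Proof.
have p_gt0 := prime_gt0 p_prime.
have H_gt0 : (0 < p ^ (k - 1))%N by rewrite expn_gt0 p_gt0.
(* Hyperplane sums are multiples of p^(k-1), and the total p^(k-1) c is below p^k because c < p. *)
have dv a : (p ^ (k - 1) %| excess a)%N.
  apply: (weights_dvdn p_prime) => // [w t nz_w|].
    rewrite -(dvdn_addl _ (dvdn_mulr (n_graph v z w t) (dvdnn (p ^ (k - 1))))).
    by rewrite sum_excess_hyperplane // dvdn_mulr.
  by rewrite sum_excess expnS mulnC ltn_pmul2r.
exists (fun a => excess a %/ p ^ (k - 1))%N.
have sumE (P : pred 'rV[K]_k) : (p ^ (k - 1) * \sum_(a | P a) (excess a %/ p ^
  (k - 1)) =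
    \sum_(a | P a) excess a)%N.
  by rewrite big_distrr; apply: eq_bigr => a _; rewrite /= mulnC divnK.
split=> [|w t nz_w]; apply/eqP; rewrite -(eqn_pmul2l H_gt0).
  by rewrite sumE sum_excess.
by rewrite mulnDr sumE sum_excess_hyperplane.
Qed.

End MissingHyperplanes.

(** * The residue as a linear code with generator matrix *)

Section Residue.

Variables (p : nat) (p_prime : prime p).
Local Notation K := 'F_p.
Local Notation V := (fsseq p).
Variables (F : nat -> V) (d m : nat).
Local Notation gen := (fun i => wminus F d (p ^ i)).
Local Notation L := (Lexminus F d m).
Local Notation act := (active L).

Definition gen_mx : 'M[K]_(m, size act) :=
  \matrix_(i, j) (gen i)`_(nth 0%N act j).

Lemma mem_Lexminus x : reflect (exists a : 'rV[K]_m, x = comb gen a) (x \in L).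
Proof.
apply: (iffP mapP) => [[b]|[a ->]].
  rewrite mem_iota add0n => /= lt_b ->.
  by exists (\row_(i < m) digit p b i); rewrite (wminus_comb p_prime F d lt_b).
have [b lt_b <-] := comb_wminus p_prime F d a.
by exists b; rewrite ?mem_iota.
Qed.

Lemma mem_active i : (i \in act) = (column gen m i != 0).
Proof.
rewrite mem_filter; apply/andP/idP => [[/hasP[x /mem_Lexminus[a ->]]]|].
  by rewrite coef_comb => nz _; apply: contraNneq nz => ->; rewrite dot0r.
case/cV0Pn => l; rewrite mxE => nz.
have genL : gen l \in L.
  apply/mem_Lexminus; exists (delta_mx 0 l); rewrite /comb (bigD1 l) //= big1.
    by rewrite mxE !eqxx scale1r addr0.
  by move=> i' ne; rewrite mxE (negPf ne) andbF scale0r.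
split; first by apply/hasP; exists (gen l).
rewrite mem_iota add0n /=; apply: leq_trans (leq_bigmax_seq _ genL isT).
by rewrite ltnNge; apply: contra nz => le; rewrite nth_default.
Qed.

Lemma sum_active B (h : nat -> nat) : gens_bounded F d m B ->
  (\sum_(j < size act) h (nth 0 act j) = \sum_(i < B | column gen m i != 0%R) h
    i)%N.
Proof.
move=> gB; rewrite -(big_mkord xpredT (fun j => h (nth 0%N act j))) -(big_nth
  0%N xpredT h).
rewrite -(big_mkord (fun i => column gen m i != 0) h) -[RHS]big_filter.
apply: perm_big; apply: uniq_perm; rewrite ?filter_uniq ?iota_uniq //.
move=> i; rewrite mem_active mem_filter mem_iota add0n subn0 /=.
case: (ltnP i B) => [|le_i]; first by rewrite andbT.
by rewrite (column_bound gB le_i) eqxx.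
Qed.

Lemma size_active B : gens_bounded F d m B ->
  size act = n_active (fun j : 'I_B => column gen m j).
Proof.
move=> gB; have := sum_active (fun=> 1%N) gB.
by rewrite sum_nat_const card_ord muln1 => ->; rewrite big_mkcond.
Qed.

Lemma col_gen_mx j : col j gen_mx = column gen m (nth 0%N act j).
Proof. by apply/colP => i; rewrite !mxE. Qed.

Lemma mul_gen_mxE (a : 'rV[K]_m) j :
  (a *m gen_mx) 0 j = (comb gen a)`_(nth 0%N act j).
Proof.
by rewrite coef_comb dotE mxE; apply: eq_bigr => i _; rewrite !mxE.
Qed.

Lemma mem_Res x : reflect (exists a, x = a *m gen_mx) (x \in Res L).
Proof.
rewrite inE; apply: (iffP mapP) => [[y /mem_Lexminus[a ->] ->]|[a ->]].
  by exists a; apply/rowP => j; rewrite mul_gen_mxE mxE.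
exists (comb gen a); first by apply/mem_Lexminus; exists a.
by apply/rowP => j; rewrite mul_gen_mxE mxE.
Qed.

Lemma row_hamming_gen_mx (a b : 'rV[K]_m) :
  row_hamming (a *m gen_mx) (b *m gen_mx) = hamming 0 (comb gen (a - b)).
Proof.
have [B gB _] := ex_gens_bound F d m 0.
rewrite (hamming_comb _ _ gB) ?size_poly0 //.
rewrite /row_hamming -sum1dep_card big_mkcond /=.
transitivity (\sum_(j < size act)
    (dot (a - b) (column gen m (nth 0 act j)) != 0%R))%N.
  apply: eq_bigr => j _; rewrite !mul_gen_mxE !coef_comb dotBl subr_eq0.
  by case: eqP.
rewrite (sum_active (fun i => dot (a - b) (column gen m i) != 0 : nat) gB).
rewrite big_mkcond; apply: eq_bigr => j _; rewrite coef0 [0 == _]eq_sym.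
by case: eqP => // ->; rewrite dot0r eqxx.
Qed.

Hypothesis weight_gt0 : forall a : 'rV[K]_m, a != 0 -> (0 < hamming 0 (comb gen
  a))%N.

Lemma mul_gen_mx_inj (a : 'rV[K]_m) : a *m gen_mx = 0 -> a = 0.
Proof.
move=> aG; apply/eqP; apply: contraT => /weight_gt0.
rewrite -[a]subr0 -row_hamming_gen_mx mul0mx aG /row_hamming.
by rewrite (_ : [set j | _] = set0) ?cards0 //; apply/setP => j;
  rewrite !inE eqxx.
Qed.

Lemma gen_mx_generator : is_generator_matrix (Res L) gen_mx.
Proof.
split; first by apply: inj_row_free => a; apply: mul_gen_mx_inj.
by move=> x; apply/mem_Res/submxP => -[a ->]; exists a.
Qed.

Lemma Res_linear : is_linear_of_dim (Res L) m.
Proof.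
pose f : 'Hom('rV[K]_m, 'rV[K]_(size act)) := linfun (mulmxr gen_mx).
exists (limg f); split.
  have := limg_ker_dim f fullv; rewrite (_ : lker f = 0%VS); last first.
    apply/eqP; rewrite -subv0; apply/subvP => a;
      rewrite memv_ker lfunE /= => /eqP.
    by move/mul_gen_mx_inj->; rewrite mem0v.
  by rewrite capv0 dimv0 add0n dimvf /dim /= mul1n.
move=> x; apply/mem_Res/memv_imgP => [[a ->]|[a _ ->]].
  by exists a; rewrite ?memvf // lfunE.
by exists a; rewrite lfunE.
Qed.

End Residue.

Section Multiset.

Variable T : finType.

(** A multiset as a list, so that its members can be indexed by an ordinal like the family of
    removed subspaces. *)
Definition seq_of_mult (g : T -> nat) : seq T :=
  flatten [seq nseq (g a) a | a <- enum T].

Lemma count_seq_of_mult g (P : pred T) :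
  count P (seq_of_mult g) = (\sum_(a | P a) g a)%N.
Proof.
rewrite count_flatten -map_comp sumnE big_map big_enum /= [RHS]big_mkcond.
by apply: eq_bigr => a _; rewrite /= count_nseq; case: (P a); rewrite ?mul1n.
Qed.

Lemma card_nth_seq (x0 : T) (s : seq T) (P : pred T) :
  #|[set i : 'I_(size s) | P (nth x0 s i)]| = count P s.
Proof.
rewrite -sum1dep_card -sum1_count (big_nth x0) big_mkord.
by apply: eq_bigl => i; rewrite ?inE.
Qed.

End Multiset.

Section Hyperplanes.

Variables (F : fieldType) (k : nat).

(** The graph of the functional w -> b.w, a hyperplane that avoids the point (0; 1). *)
Definition graph_space (b : 'rV[F]_k) : {vspace 'cV[F]_(k + 1)} :=
  lker (linfun (mulmx (row_mx (- b) 1%:M))).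

Lemma mem_graph_space b w t :
  (col_mx w t%:M \in graph_space b) = (dot b w == t).
Proof.
rewrite memv_ker lfunE /= mul_row_col mul1mx mulNmx addrC subr_eq0.
rewrite [b *m w]mx11_scalar eq_sym -/(dot b w).
apply/eqP/eqP => [/matrixP/(_ 0 0)|->//]; by rewrite !mxE eqxx !mulr1n.
Qed.

Lemma graph_space_proper b : graph_space b != fullv.
Proof.
apply/eqP => fullE; have := memvf (col_mx (0 : 'cV[F]_k) (1 : F)%:M).
by rewrite -fullE mem_graph_space dot0r eq_sym oner_eq0.
Qed.

End Hyperplanes.

Lemma dim1_vline (F : fieldType) (vT : vectType F) (P : {vspace vT}) :
  \dim P = 1%N -> exists2 x, x != 0 & P = <[x]>%VS.
Proof.
move=> dimP; have nz : vpick P != 0 by rewrite vpick0 -dimv_eq0 dimP.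
exists (vpick P) => //; apply/esym/eqP; rewrite eqEdim dim_vline nz dimP.
by rewrite -memvE memv_pick.
Qed.

Lemma vline_eq (F : fieldType) (vT : vectType F) (x y : vT) : x != 0 ->
  (<[x]>%VS == <[y]>%VS) = (x \in <[y]>%VS).
Proof.
move=> nz; apply/eqP/idP => [<-|xy]; first exact: memv_line.
by apply/eqP; rewrite eqEdim -memvE xy !dim_vline nz; case: (y != 0).
Qed.

(** * Parameters and point multiplicities of the final code *)

Section LastWord.

Variables (p : nat) (p_prime : prime p).
Local Notation K := 'F_p.
Local Notation V := (fsseq p).
Variables (F : nat -> V) (F_family : basis_family F) (k q r d : nat).
Hypotheses (k_ge1 : (1 <= k)%N) (r_gt0 : (0 < r)%N) (lt_rp : (r < p)%N).
Hypotheses (lt_pqr : (p < q + r)%N) (d_def : d = (p ^ (k - 1) * (p * q + r))%N).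
Local Notation gen := (fun i => wminus F d (p ^ i)).
Local Notation u := (p * q + r)%N.
Local Notation G := (gen_mx F d (k + 1)).
Local Notation vB B := (fun j : 'I_B => column gen k j).
Local Notation zB B := (fun j : 'I_B => (gen k)`_j).

Lemma designed_distance_gt0 : (0 < d)%N.
Proof. by rewrite d_def muln_gt0 expn_gt0 prime_gt0 // addn_gt0 r_gt0 orbT. Qed.

(** Here U = u, c = p - r and e = q + 1. From p < q + r and r < p one gets q >= 2, hence e >= 3, and
    also c <= e. *)
Lemma last_word_spec : exists n,
  [/\ forall B, gens_bounded F d k B -> n_active (vB B) = n,
      forall a : 'rV[K]_k, a != 0 -> hamming 0 (comb gen a) = d,
      ((p - 1) * n + u = p * d)%N,
      far F d k (gen k) &
      size (extra (fun j => column gen k j != 0) (gen k)) = (q + 1)%N].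
Proof.
have p_gt0 := prime_gt0 p_prime; have p_gt1 := prime_gt1 p_prime.
have q_ge2 : (2 <= q)%N by lia.
have u_ge3 : (3 <= u)%N by nia.
have [beta [xi [eta [ne beta01 FE]]]] := basis_familyE F_family.
have [n [len wt holes]] := simplex_prefix p_prime beta01 ne FE
  designed_distance_gt0 u_ge3 k_ge1 d_def (leqnn k).
rewrite subnn expn0 muln1 => nU.
have pd : (u * p ^ k = p * d)%N by rewrite d_def mulnA -expnS subn1 prednK //
  mulnC.
have uc : (u + (p - r) = p * (q + 1))%N by rewrite mulnDr muln1 -addnA subnKC
  // ltnW.
have [|||far_g size_e _ _] := gen_step p_prime beta01 ne FE
  designed_distance_gt0 len wt holes nU pd uc.
- by rewrite -{2}(subn0 p) ltn_sub2l.
- lia.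
- by rewrite addn1 ltnS.
by exists n.
Qed.

Lemma last_code_weight_ge (a : 'rV[K]_(k + 1)) : a != 0 -> (d <= hamming 0
  (comb gen a))%N.
Proof.
have [n [_ wt _ far_g _]] := last_word_spec.
move=> nz_a; have [a0|nz] := eqVneq (rsubmx a 0 0) 0.
  by rewrite hamming_comb_pred // wt // lsubmx_neq0.
by rewrite hamming_comb_succ.
Qed.

Lemma last_code_weight_gt0 (a : 'rV[K]_(k + 1)) : a != 0 -> (0 < hamming 0
  (comb gen a))%N.
Proof. by move=> /last_code_weight_ge;
  apply: leq_trans designed_distance_gt0. Qed.

Lemma Res_min_distance : is_min_distance (Res (Lexminus F d (k + 1))) d.
Proof.
have [n [_ wt _ _ _]] := last_word_spec.
split=> [x y /(mem_Res p_prime)[a ->] /(mem_Res p_prime)[b ->] ne_ab|].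
  rewrite row_hamming_gen_mx // last_code_weight_ge // subr_eq0.
  by apply: contraNneq ne_ab => ->.
pose l : 'rV[K]_k := delta_mx 0 (Ordinal k_ge1).
have nz_l : l != 0.
  apply/eqP => /matrixP/(_ 0 (Ordinal k_ge1)); rewrite !mxE !eqxx => /eqP.
  by rewrite oner_eq0.
have wl : row_hamming (row_mx l 0 *m G) (0 *m G) = d.
  by rewrite row_hamming_gen_mx // subr0 hamming_comb_pred ?row_mxKr ?mxE //
    row_mxKl wt.
exists (row_mx l 0 *m G), (0 *m G); split=> //.
- by apply/(mem_Res p_prime); exists (row_mx l 0).
- by apply/(mem_Res p_prime); exists 0.
apply/eqP => e0; have := designed_distance_gt0;
  rewrite -wl e0 /row_hamming lt0n cards_eq0 => /eqP; apply.
by apply/setP => j; rewrite !inE eqxx.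
Qed.

Lemma length_Res :
  size (active (Lexminus F d (k + 1))) = ((p ^ k - 1) %/ (p - 1) * u + q + 1)%N.
Proof.
have p_gt0 := prime_gt0 p_prime; have p_gt1 := prime_gt1 p_prime.
have [n [len _ nU _ size_e]] := last_word_spec.
have [B gB _] := ex_gens_bound F d (k + 1) 0.
rewrite (size_active p_prime gB) (n_active_succ len size_e gB) addnA.
congr (_ + _ + _)%N.
have p1_gt0 : (0 < p - 1)%N by rewrite subn_gt0.
have p1_dvd : (p - 1 %| p ^ k - 1)%N by rewrite !subn1 predn_exp dvdn_mulr.
apply/eqP; rewrite -(eqn_pmul2l p1_gt0) mulnA [((p - 1) * (_ %/ _))%N]mulnC
  divnK //.
rewrite -(eqn_add2r u) nU d_def mulnA -expnS subn1 prednK //.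
by rewrite mulnBl mul1n subnK // leq_pmull // expn_gt0 p_gt0.
Qed.

(** For w = 0 the point is (0; 1), and the columns on it come exactly from the coordinates that the
    last word adds. *)
Lemma point_multiplicity (w : 'cV[K]_k) (t : K) B : gens_bounded F d (k + 1) B
  ->
  col_mx w t%:M != 0 ->
  #|[set j | <[col j G]>%VS == <[col_mx w t%:M]>%VS]|
    = (if w == 0 then n_extra (vB B) (zB B) else n_graph (vB B) (zB B) w t).
Proof.
move=> gB nz_x; set x := col_mx w _.
pose h i : nat := (<[column gen (k + 1) i]>%VS == <[x]>%VS).
transitivity (\sum_(j < size (active (Lexminus F d (k + 1))))
    h (nth 0 (active (Lexminus F d (k + 1))) j))%N.
  by rewrite -sum1dep_card big_mkcond; apply: eq_bigr => j _;
    rewrite col_gen_mx /h; case: eqP.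
rewrite (sum_active p_prime h gB) big_mkcond /=.
transitivity (\sum_(j < B) ((column gen (k + 1) j != 0%R) && (column gen (k +
  1) j \in <[x]>%VS)))%N.
  apply: eq_bigr => j _; case: (boolP (column _ _ _ == 0)) => //= nz.
  by rewrite /h vline_eq.
have scal_col l (w' : 'cV[K]_k) (t' : K) : l *: col_mx w' t'%:M = col_mx (l *:
  w') (l * t')%:M.
  by rewrite scale_col_mx scale_scalar_mx.
case: eqVneq => [w0|nz_w]; apply: eq_bigr => j _ /=; congr (nat_of_bool _);
  rewrite column_succ_neq0 column_succ.
  apply/andP/andP => [[nz /vlineP[l]]|[/eqP v0 nz_z]].
    rewrite scal_col w0 scaler0 => /eq_col_mx[v0 _].
    by rewrite v0 eqxx in nz *.
  rewrite v0 nz_z orbT; split=> //; apply/vlineP; exists ((gen k)`_j / t).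
  rewrite scal_col w0 scaler0 divfK //.
  by apply: contraNneq nz_x => ->; rewrite w0 raddf0 col_mx0.
apply/andP/andP => [[nz /vlineP[l]]|[nz /existsP[l /andP[/eqP vl /eqP zl]]]].
  rewrite scal_col => /eq_col_mx[vl zl].
  have zl' : (gen k)`_j = l * t by have /matrixP/(_ 0 0) := zl;
    rewrite !mxE eqxx !mulr1n.
  split; last by apply/existsP; exists l; rewrite vl zl' !eqxx.
  rewrite vl scaler_eq0 (negPf nz_w) orbF; apply: contraTneq nz => l0.
  by rewrite vl zl' l0 scale0r mul0r !eqxx.
by split; [rewrite nz | apply/vlineP; exists l; rewrite scal_col -vl -zl].
Qed.

Lemma Res_Solomon_Stiffler : is_Solomon_Stiffler (Res (Lexminus F d (k + 1)))
  (k + 1).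
Proof.
have p_gt0 := prime_gt0 p_prime; have p_gt1 := prime_gt1 p_prime.
have [n [len wt nU far_g size_e]] := last_word_spec.
have pd : (u * p ^ k = p * d)%N by rewrite d_def mulnA -expnS subn1 prednK //
  mulnC.
have uc : (u + (p - r) = p * (q + 1))%N by rewrite mulnDr muln1 -addnA subnKC
  // ltnW.
exists G; split.
- by apply: gen_mx_generator => // a; apply: last_code_weight_gt0.
- by move=> j; rewrite col_gen_mx -(mem_active p_prime) mem_nth.
have [B gB _] := ex_gens_bound F d (k + 1) 0.
have gB0 : gens_bounded F d k B by move=> i lt_i; apply: gB;
  rewrite addn1 ltnS ltnW.
have genB : (size (gen k) <= B)%N by apply: gB; rewrite addn1.
have extra_e : n_extra (vB B) (zB B) = (q + 1)%N by rewrite -size_e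
  -(size_extra _ _ _ genB).
have line_u w : w != 0 -> n_line (vB B) w = u.
  by apply: (class_size p_prime len wt nU pd gB0).
have far_dist a : (d <= word_dist (vB B) (zB B) a)%N by rewrite -(hamming_comb
  _ genB gB0).
have lt_cp : (p - r < p)%N by rewrite -{2}(subn0 p) ltn_sub2l.
have nU' : ((p - 1) * n_active (vB B) + u = p * d)%N by rewrite len.
have [g [sum_g graph_g]] := missing_hyperplanes p_prime k_ge1 lt_cp line_u
  extra_e far_dist nU' uc.
pose bs := seq_of_mult g.
have size_bs : size bs = (p - r)%N by rewrite -count_predT count_seq_of_mult.
pose U (i : 'I_(size bs)) := graph_space (nth 0 bs i).
have mult_missing (x : 'cV[K]_(k + 1)) : x != 0 ->
    (#|[set j | <[col j G]>%VS == <[x]>%VS]| + #|[set i | (<[x]> <= U i)%VS]| =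
      q + 1)%N.
  rewrite -[x]vsubmxK [dsubmx x]mx11_scalar;
    move: (usubmx x) (dsubmx x 0 0) => w t nz_x.
  rewrite (point_multiplicity gB nz_x).
  rewrite (_ : [set i | _] = [set i : 'I_(size bs) | dot (nth 0 bs i) w == t]);
    last first.
    by apply/setP => i; rewrite !inE -memvE mem_graph_space.
  rewrite (card_nth_seq 0 bs (fun b => dot b w == t)) count_seq_of_mult.
  (* At (0; 1) nothing is removed and the q + 1 new coordinates give the full multiplicity;
     elsewhere the count is that of [missing_hyperplanes]. *)
  case: eqVneq => [w0|nz_w]; last by rewrite addnC graph_g.
  rewrite extra_e big1 ?addn0 // => a; rewrite w0 dot0r => /eqP t0.
  by rewrite w0 -t0 raddf0 col_mx0 eqxx in nz_x.
exists (q + 1)%N, (size bs), U; split.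
- by move=> i; apply: graph_space_proper.
(* The whole family has only p - r <= p - 1 members, whatever their dimensions. *)
- move=> e; apply: leq_trans (max_card _) _; rewrite card_ord size_bs.
  exact: leq_sub2l.
- by move=> P /dim1_vline[x nz_x ->]; rewrite -(mult_missing x nz_x) leq_addl.
- by move=> P /dim1_vline[x nz_x ->]; rewrite -(mult_missing x nz_x) addnK.
Qed.

End LastWord.

Local Close Scope ring_scope.

Theorem theorem1p11 (p : nat) (p_prime : prime p)
    (F : nat -> fsseq p) (F_family : basis_family F)
    (k q r d : nat) (k_ge1 : 1 <= k) (r_gt0 : 0 < r) (r_ltp : r < p)
    (d_def : d = p ^ (k - 1) * (p * q + r))
    (hqr : (2 <= q%:Z + r%:Z - p%:Z + 1 :> int)%R) :
  is_nmd_code (Res (Lexminus F d (k + 1)))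
    ((p ^ k - 1) %/ (p - 1) * (p * q + r) + q + 1) (k + 1) d /\
  is_Solomon_Stiffler (Res (Lexminus F d (k + 1))) (k + 1).
Proof.
have lt_pqr : p < q + r by lia.
split; last by apply: Res_Solomon_Stiffler d_def.
split; [by apply: length_Res d_def | | by apply: Res_min_distance d_def].
by apply: Res_linear => // a; apply: last_code_weight_gt0 d_def _.
Qed.
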